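(* Let $p\ge4$ be an even integer and let $(X_i)_{i\in\mathbb Z}$ be a stationary sequence of random variables in $\mathbf L^p$, adapted to $(\mathcal F_i)_{i\in\mathbb Z}$ (setting described in the context). Then there is a constant $C_p$ depending only on $p$ such that for every positive integer $n$, $$ \mathbf E\Bigl(\max_{1\le j\le n}|S_j|^p\Bigr)\le C_p\Biggl[n\|X_0\|_p^p+n^{1-p}\Biggl(\sum_{i=1}^n\|\mathbf E_0(S_i)\|_p\Biggr)^p+n\Biggl(\sum_{k=1}^n\frac{1}{k^{1+4/(p(p-2))}}\|\mathbf E_0(S_k^2)\|_{p/2}^{2/(p-2)}\Biggr)^{p(p-2)/4}\Biggr]. $$
   Context: Setting: $(\Omega,\mathcal A,\mathbf P)$ is a probability space and $T:\Omega\to\Omega$ is a bijective bi-measurable transformation preserving $\mathbf P$. $\mathcal F_0\subseteq\mathcal A$ is a $\sigma$-algebra with $\mathcal F_0\subseteq T^{-1}(\mathcal F_0)$, and $\mathcal F_i=T^{-i}(\mathcal F_0)$, $i\in\mathbb Z$. $X_0$ is a real-valued random variable and $X_i=X_0\circ T^i$. The sequence is adapted if $X_0$ is $\mathcal F_0$-measurable. Notation: $\mathbf E_0(Y)=\mathbf E(Y\mid\mathcal F_0)$, $\|\cdot\|_p$ is the norm in $\mathbf L^p$, $S_n=\sum_{j=1}^nX_j$. The constant $C_p$ does not depend on $n$ nor on the underlying random variables. *)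

(* Defs.v *)
From HB Require Import structures.
From mathcomp Require Import all_boot all_order all_algebra.
From mathcomp Require Import all_classical all_reals all_analysis measurable_realfun.
Import Order.TTheory GRing.Theory Num.Theory.
Import numFieldNormedType.Exports.

Set Implicit Arguments.
Unset Strict Implicit.
Unset Printing Implicit Defensive.

Local Open Scope classical_set_scope.
Local Open Scope ring_scope.

Section sub_sigma_algebra.
Context {d : measure_display} {Omega : measurableType d} {R : realType}.
Implicit Types (P : probability Omega R) (F : set (set Omega)).
Implicit Types Y Z : Omega -> R.

Definition measurable_wrt F Z := forall B : set R, measurable B -> F (Z @^-1` B).

Definition is_condexp P F Y Z :=
  [/\ measurable_wrt F Z, P.-integrable setT (EFin \o Z) &
      forall A, F A ->
        (\int[P]_(x in A) (Z x)%:E = \int[P]_(x in A) (Y x)%:E)%E].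

(* A version of E(Y | F); two versions agree P-almost everywhere. [condexpP]
   shows that the default value is never used for integrable [Y]. *)
Definition condexp P F Y : Omega -> R := xget (cst 0) [set Z | is_condexp P F Y Z].

Lemma condexpP P F Y : sigma_algebra setT F -> F `<=` measurable ->
  P.-integrable setT (EFin \o Y) -> is_condexp P F Y (condexp P F Y).
Proof.
move=> sF FM iY; suff [Z YZ] : exists Z, is_condexp P F Y Z.
  exact: (xgetPex (cst 0) (ex_intro [set Z | is_condexp P F Y Z] Z YZ)).
have mF (A : set (g_sigma_algebraType F)) : measurable A = F A.
  by rewrite -[in RHS](sigma_algebra_id sF).
have mid : measurable_fun setT (idfun : Omega -> g_sigma_algebraType F).
  by move=> _ A; rewrite mF setTI => /FM.
pose idF : {mfun Omega >-> g_sigma_algebraType F} := HB.pack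
  (idfun : Omega -> g_sigma_algebraType F) (isMeasurableFun.Build _ _ _ _ _ mid).
pose mu : probability (g_sigma_algebraType F) R := distribution P idF.
have midF : measurable_fun setT idF by [].
pose nu0 : {charge set (g_sigma_algebraType F) -> \bar R} :=
  pushforward (induced_charge iY) idF.
pose nu := nu0 midF.
have numu : nu `<< mu.
  apply/null_content_dominatesP => A; rewrite mF => /FM mA muA.
  apply: null_set_integral => //.
  have /integrableP[mY _] := iY.
  by apply: measurable_funS mY.
pose f := Radon_Nikodym nu mu.
have ffin x : f x \is a fin_num by exact: Radon_Nikodym_fin_num.
have fi : mu.-integrable setT f by exact: Radon_Nikodym_integrable.
have /integrableP[mf _] := fi.
pose g : Omega -> \bar R := f.
have giP : P.-integrable setT g.
  have mg : measurable_fun [set: Omega] g.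
    move=> _ B mB; rewrite setTI; apply/FM.
    by rewrite -mF -[X in measurable X]setTI; exact: mf.
  apply/integrableP; split=> //; move/integrableP : fi => [_].
  by rewrite ge0_integral_pushforward//; exact: measurableT_comp.
exists (fine \o g).
have gK : EFin \o (fine \o g) = g.
  by apply/funext => x /=; rewrite fineK//; exact: ffin.
split.
- move=> B mB; rewrite -mF -[X in measurable X]setTI.
  have mfine : measurable_fun [set: g_sigma_algebraType F] (fine \o f).
    by apply: measurableT_comp mf.
  exact: mfine.
- by rewrite gK.
move=> A FA; have mA : measurable (A : set (g_sigma_algebraType F)) by rewrite mF.
have := Radon_Nikodym_integral numu mA.
rewrite /= -/f integral_pushforward//; last first.
  by apply: (integrableS measurableT) => //; exact: FM.
rewrite /pushforward /induced_charge /= => ->.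
by apply: eq_integral => x _; rewrite -[LHS]/((EFin \o (fine \o g)) x) gK.
Qed.

End sub_sigma_algebra.

Section stationary_process.
Context {d : measure_display} {Omega : measurableType d} {R : realType}.
Implicit Types T Tinv : Omega -> Omega.

(* [T ^ i] for [i : int], where [Tinv] is the inverse of [T]. *)
Definition shift T Tinv (i : int) : Omega -> Omega :=
  match i with Posz k => iter k T | Negz k => iter k.+1 Tinv end.

Definition stationary T Tinv (X0 : Omega -> R) (i : int) : Omega -> R :=
  X0 \o shift T Tinv i.

Definition partial_sum (X : int -> Omega -> R) (n : nat) : Omega -> R :=
  fun x => \sum_(1 <= j < n.+1) X j%:Z x.

End stationary_process.

(* Main.v *)
Require Import Defs.
From mathcomp Require Import all_boot all_order all_algebra.
From mathcomp Require Import all_classical all_reals all_analysis measurable_realfun.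
From mathcomp Require Import finmap ring lra.
Import Order.TTheory GRing.Theory Num.Theory.
Import numFieldNormedType.Exports.
Import HBNNSimple.
Local Open Scope classical_set_scope.
Local Open Scope ring_scope.

Set Implicit Arguments.
Unset Strict Implicit.
Unset Printing Implicit Defensive.

(* Put n for the length of the sum, h_i := E_0(S_i), theta := (1/n) sum_(i <= n) h_i
   and bbar := (1/n) sum_(i <= n) |h_i|_p. Gordin's decomposition writes
   S_k = M_k + theta - theta o T^k + (1/n) sum_(j <= k) h_n o T^j, where M_k is a
   martingale with stationary differences. Subadditivity of i |-> |h_i|_p gives
   |h_n|_p <= 4 bbar, so the maximum of |S_k - M_k|^p has expectation at most
   C n bbar^p, which is the second term of the bound, and |S_k - M_k|_p <= 6 bbar.

   For the martingale, a pathwise form of the inequalities of Doob and Burkholder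
   bounds E max |M_k|^p by the moment E Q_n^q of the quadratic variation, q := p/2.
   Expanding (a + b)^q for the two halves a, b of Q_(2m), every mixed term
   a^(q-j) b^j is controlled by b^q and a^(q-1) b, and E(a^(q-1) b) involves only
   E_0(Q_m) = E_0(M_m^2). Hence, with v_m^(q(q-1)) = E Q_m^q,
     v_(2m) <= 2^(1/(q(q-1))) (v_m + C |E_0(M_k^2)|_q^(1/(q-1)))  for all k >= m,
   and iterating over the powers of two gives the third term. *)

(** * Elementary inequalities *)

(** The norms of E_0(S_k^2) need not be monotone in k, yet the bound sums them with fixed weights.
    This is why the recursion runs on the quadratic variation: Q_m <= Q_k pointwise for m <= k, so a
    doubling step may use any k of its dyadic block, and the smallest term of a block is controlled
    by the weighted sum over that block. The exponents come from one balance. Each doubling step has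
    two free parameters, l for the mixed terms and t for Young's inequality. With l = w / v and t =
    l^(q-1), all error terms are multiples of (w / v) v^s exactly when s = q(q-1) = p(p-2)/4. The
    doubling factor is then 2 = rho^s with rho = 2^(1/s), and in the weight k^-(1 + 1/s) the factor
    k^-1 averages over a block while k^(-1/s) compensates rho^i. For p even, q is an integer: the
    pathwise inequalities are polynomial and the binomial expansion is finite. Conditional
    expectations are bounded in L^p only up to a factor 2, obtained from Young's inequality; this
    affects the constant alone. *)

Ltac nonneg := repeat first [assumption | exact: ltW | exact: ler01 | exact: ler0n
  | exact: normr_ge0 | apply: sqr_ge0 | apply: exprn_ge0 | apply: mulr_ge0 | apply: addr_ge0
  | rewrite invr_ge0].

Section real_inequalities.
Context {R : realFieldType}.
Implicit Types (x y t u m d a b l : R) (r n k : nat).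

(** According as y <= t x or not, one of the two terms on the right dominates alone. The constants
    are not sharp, but t is free, so either term can be absorbed later. *)
Lemma young_pow k x y t : 0 <= x -> 0 <= y -> 0 < t ->
  x ^+ k * y <= t * x ^+ k.+1 + t^-1 ^+ k * y ^+ k.+1.
Proof.
move=> x0 y0 t0; have [ytx|txy] := leP y (t * x).
  rewrite -[leLHS]addr0 lerD ?mulr_ge0 ?exprn_ge0 ?invr_ge0 ?(ltW t0)//.
  by rewrite exprSr mulrCA ler_wpM2l ?exprn_ge0.
rewrite -[leLHS]add0r lerD ?mulr_ge0 ?exprn_ge0 ?(ltW t0)//.
rewrite exprSr mulrA ler_wpM2r// -exprMn lerXn2r ?nnegrE ?mulr_ge0 ?invr_ge0 ?(ltW t0)//.
by rewrite ler_pdivlMl// ltW.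
Qed.

Lemma exprD_le k x y : 0 <= x -> 0 <= y ->
  (x + y) ^+ k <= 2 ^+ k * (x ^+ k + y ^+ k).
Proof.
move=> x0 y0; wlog xy : x y x0 y0 / x <= y => [H|].
  have [/H->//|/ltW yx] := leP x y.
  by rewrite addrC [X in _ * X]addrC H.
apply: (@le_trans _ _ ((2 * y) ^+ k)).
  by rewrite lerXn2r ?nnegrE ?addr_ge0 ?mulr_ge0// mulrDl !mul1r lerD2r.
by rewrite exprMn ler_wpM2l ?exprn_ge0// lerDr exprn_ge0.
Qed.

(** Comparison with the largest term. The exponent k+1 on n is one more than optimal; the loss is
    affordable for the remainder, whose target already has a factor n. *)
Lemma expr_sum_le n k (y : nat -> R) : (forall i, 0 <= y i) ->
  (\sum_(i < n) y i) ^+ k.+1 <= n%:R ^+ k.+1 * \sum_(i < n) y i ^+ k.+1.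
Proof.
move=> y0; case: n => [|n]; first by rewrite !big_ord0 expr0n/= mulr0.
pose i0 := [arg max_(i > (ord0 : 'I_n.+1)) y i]%O.
have yi0 (i : 'I_n.+1) : y i <= y i0.
  by rewrite /i0; case: arg_maxP => //= j _; apply.
apply: (@le_trans _ _ ((n.+1%:R * y i0) ^+ k.+1)).
  rewrite lerXn2r ?nnegrE ?mulr_ge0 ?sumr_ge0//.
  apply: le_trans (ler_sum _ (fun i _ => yi0 i)) _.
  by rewrite sumr_const card_ord mulr_natl.
rewrite exprMn ler_wpM2l ?exprn_ge0// (bigD1 i0)//= lerDl.
by rewrite sumr_ge0// => i _; rewrite exprn_ge0.
Qed.

(* According as [a <= l b] or not, a mixed term [a^(q-j) b^j] of the expansion is
   at most [l b^q] or [l^-(q-2) a^(q-1) b], where [q = r.+2]. *)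
Lemma block_ineq r a b l : 0 <= a -> 0 <= b -> 0 < l -> l <= 1 ->
  (a + b) ^+ r.+2 <= a ^+ r.+2 + b ^+ r.+2 +
    2 ^+ r.+2 * (l * b ^+ r.+2 + l^-1 ^+ r * (a ^+ r.+1 * b)).
Proof.
move=> a0 b0 l0 l1; set Z := l * _ + _.
have l'1 : 1 <= l^-1 by rewrite invf_ge1.
have l'0 : 0 <= l^-1 by rewrite invr_ge0 ltW.
have Z0 : 0 <= Z by rewrite /Z; nonneg.
have mid i : (i <= r)%N -> a ^+ (r.+1 - i) * b ^+ i.+1 <= Z.
  move=> ir; have [alb|lba] := leP a (l * b).
    rewrite -[leLHS]addr0 lerD//; last by nonneg.
    apply: (@le_trans _ _ ((l * b) ^+ (r.+1 - i) * b ^+ i.+1)).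
      by rewrite ler_wpM2r ?exprn_ge0// lerXn2r// nnegrE; nonneg.
    rewrite exprMn -mulrA -exprD (_ : (r.+1 - i + i.+1 = r.+2)%N); last first.
      by rewrite addnS subnK// ltnW.
    by rewrite ler_wpM2r ?exprn_ge0// subSn// exprS ler_piMr ?exprn_ile1 ?(ltW l0).
  rewrite -[leLHS]add0r lerD//; first by nonneg.
  have bal : b <= l^-1 * a by rewrite ler_pdivlMl// ltW.
  apply: (@le_trans _ _ (a ^+ (r.+1 - i) * ((l^-1 * a) ^+ i * b))).
    rewrite ler_wpM2l ?exprn_ge0// exprSr ler_wpM2r// lerXn2r ?nnegrE//.
    by rewrite mulr_ge0.
  rewrite exprMn mulrA [X in X * b]mulrCA -mulrA -exprD subnK; last exact: ltnW.
  by rewrite ler_wpM2r ?mulr_ge0 ?exprn_ge0// ler_weXn2l.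
rewrite exprDn big_ord_recl big_ord_recr/= !subn0 subnn !expr0 mulr1 mul1r.
rewrite bin0 /bump/= add1n binn !mulr1n -[leRHS]addrA lerD2l.
rewrite addrC lerD2l.
apply: (@le_trans _ _ (\sum_(i < r.+1) Z *+ 'C(r.+2, i.+1))).
  apply: ler_sum => i _; rewrite /bump/= add1n subSS lerMn2r.
  by rewrite mid ?orbT// -ltnS.
rewrite sumrMnr -natrX -[leLHS]mulr_natl ler_wpM2r// ler_nat.
rewrite -[X in (_ <= X ^ _)%N]/(1 + 1)%N expnDn big_ord_recl.
apply: leq_trans (leq_addl _ _).
rewrite [leqRHS]big_ord_recr; apply: leq_trans (leq_addr _ _).
by apply: leq_sum => i _; rewrite !exp1n !muln1.
Qed.

(** Taylor's formula of order two by induction: the remainder of degree k+3 is y times that of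
    degree k+2, plus (k+2) x^(k+1) (y - x)^2. *)
Lemma tangent_ineq k x y u : 0 <= x -> 0 <= y -> x <= u -> y <= u ->
  y ^+ k.+2 - x ^+ k.+2 - k.+2%:R * x ^+ k.+1 * (y - x)
    <= k.+2%:R ^+ 2 * u ^+ k * (y - x) ^+ 2.
Proof.
move=> x0 y0 xu yu; have u0 := le_trans x0 xu.
elim: k => [|k IH].
  rewrite expr0 mulr1 expr1; have := sqr_ge0 (y - x); nra.
have -> : y ^+ k.+3 - x ^+ k.+3 - k.+3%:R * x ^+ k.+2 * (y - x) =
   y * (y ^+ k.+2 - x ^+ k.+2 - k.+2%:R * x ^+ k.+1 * (y - x)) +
   k.+2%:R * x ^+ k.+1 * (y - x) ^+ 2.
  have -> : k.+3%:R = k.+2%:R + 1 :> R by rewrite natr1.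
  by rewrite !exprS; ring.
apply: (@le_trans _ _ (y * (k.+2%:R ^+ 2 * u ^+ k * (y - x) ^+ 2) +
   k.+2%:R * u ^+ k.+1 * (y - x) ^+ 2)).
  rewrite lerD ?ler_wpM2l// ler_wpM2r ?sqr_ge0// ler_wpM2l//.
  by rewrite lerXn2r.
rewrite mulrA -mulrDl ler_wpM2r ?sqr_ge0//.
apply: (@le_trans _ _ (k.+2%:R ^+ 2 * u ^+ k.+1 + k.+2%:R * u ^+ k.+1)).
  by rewrite lerD2r mulrCA ler_wpM2l ?sqr_ge0// exprS ler_wpM2r// exprn_ge0.
rewrite -mulrDl ler_wpM2r ?exprn_ge0//.
rewrite -natrX -natrD -natrX ler_nat -[k.+3]addn1 sqrnD -addnA.
by rewrite leq_add2l muln1 mul2n -addnn addnCA leq_addr.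
Qed.

Lemma sum_sqr_le n (f : nat -> R) :
  \sum_(i < n) f i ^+ 2 <= (\sum_(i < n) `|f i|) ^+ 2.
Proof.
elim: n => [|n IH]; first by rewrite !big_ord0 expr0n.
rewrite !big_ord_recr/= sqrrD real_normK ?num_real// lerD2r.
by apply: le_trans IH _; rewrite lerDl mulrn_wge0// mulr_ge0// sumr_ge0.
Qed.

End real_inequalities.

(** * A pathwise maximal inequality *)

Fixpoint runmax {R : realDomainType} (f : nat -> R) (n : nat) : R :=
  if n is m.+1 then Num.max (runmax f m) (f n) else f 0%N.

Section pathwise.
Context {R : realFieldType}.
Implicit Types (D f : nat -> R) (r n i j : nat).

Lemma runmax_ge f n i : (i <= n)%N -> f i <= runmax f n.
Proof.
elim: n => [|n IH] /=; first by rewrite leqn0 => /eqP->.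
by rewrite leq_eqVlt ltnS le_max => /predU1P[->|/IH->]//; rewrite lexx orbT.
Qed.

Lemma runmax_le f n (c : R) : (forall i, (i <= n)%N -> f i <= c) -> runmax f n <= c.
Proof.
elim: n => [|n IH] /= H; first exact: H.
by rewrite ge_max H// IH// => i /leqW/H.
Qed.

Let M D n := \sum_(i < n) D i.
Let U D n := runmax (fun k => M D k ^+ 2) n.

Let U0 D n : 0 <= U D n.
Proof. by apply: le_trans (runmax_ge (fun k => M D k ^+ 2) (leq0n n)); exact: sqr_ge0. Qed.

Let MU D n i : (i <= n)%N -> M D i ^+ 2 <= U D n.
Proof. exact: (runmax_ge (fun k => M D k ^+ 2)). Qed.

Let MS D n : M D n.+1 = M D n + D n.
Proof. by rewrite /M big_ord_recr. Qed.

(* Summation by parts in [U^(r+1) M^2], where [U] increases only when it equals [M^2]. *)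
Let doob D r n : 2^-1 * U D n ^+ r.+2 <=
  U D n ^+ r.+1 * M D n ^+ 2 - 2 * \sum_(i < n) U D i ^+ r.+1 * M D i * D i.
Proof.
elim: n => [|n IH].
  rewrite big_ord0 /U /= /M big_ord0 expr0n/= !expr0n/= mulr0 mul0r mulr0 subr0.
  exact: lexx.
rewrite big_ord_recr/= MS; set s := \sum_(i < n) _ in IH *.
move: IH; set m := M D n; set d := D n; set u := U D n.
have u0 : 0 <= u by exact: U0.
have -> : U D n.+1 = Num.max u ((m + d) ^+ 2) by rewrite /U /= MS.
move=> IH.
have [yu|uy] := leP ((m + d) ^+ 2) u.
  suff : 0 <= u ^+ r.+1 * d ^+ 2 by move: IH; rewrite sqrrD; lra.
  by nonneg.
set y := (m + d) ^+ 2 in uy *.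
have y0 : 0 <= y by exact: sqr_ge0.
have h1 : u ^+ r * (y - u) <= y ^+ r.+1 - u ^+ r.+1.
  have -> : y ^+ r.+1 - u ^+ r.+1 = y ^+ r * (y - u) + (y ^+ r - u ^+ r) * u.
    by rewrite !exprSr; ring.
  rewrite -[leLHS]addr0 lerD//.
    by rewrite ler_wpM2r ?subr_ge0 ?(ltW uy)// lerXn2r// ltW.
  by rewrite mulr_ge0// subr_ge0 lerXn2r// ltW.
(* When y becomes the new maximum, the induction hypothesis reduces the goal to 2 u^(r+1) y -
   u^(r+2) <= y^(r+2), which is this inequality rearranged. *)
have h2 : u ^+ r.+1 * (y - u) <= y * (y ^+ r.+1 - u ^+ r.+1).
  rewrite [u ^+ _ in leLHS]exprS -mulrA; apply: ler_pM => //.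
  - by rewrite mulr_ge0 ?exprn_ge0// subr_ge0 ltW.
  - exact: ltW.
have h3 : 0 <= u ^+ r.+1 * d ^+ 2 by nonneg.
have e : u ^+ r.+1 * m ^+ 2 + 2 * (u ^+ r.+1 * m * d) + u ^+ r.+1 * d ^+ 2 = u ^+ r.+1 * y.
  by rewrite /y; ring.
have -> : y ^+ r.+2 = y ^+ r.+1 * y by rewrite exprSr.
move: IH h2; rewrite (exprSr u r.+1) mulrBr (mulrBr y); lra.
Qed.

(* Summing [tangent_ineq] at [M_i^2], as [(M_(i+1)^2 - M_i^2)^2 <= 4 U D_i^2]. *)
Let burk D r n : (M D n ^+ 2) ^+ r.+2 <=
  2 * r.+2%:R * \sum_(i < n) (M D i ^+ 2) ^+ r.+1 * M D i * D i +
  5 * r.+2%:R ^+ 2 * (U D n ^+ r.+1 * \sum_(i < n) D i ^+ 2).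
Proof.
elim: n => [|n IH].
  by rewrite !big_ord0 /M big_ord0 !expr0n/= !mulr0 addr0.
rewrite 2!big_ord_recr/= mulrDr (mulrDr (U D n.+1 ^+ _)) mulrDr.
have uu : U D n <= U D n.+1 by rewrite {2}/U /= le_max lexx.
have q0 : 0 <= 5 * r.+2%:R ^+ 2 :> R by nonneg.
have Q0 : 0 <= \sum_(i < n) D i ^+ 2 by rewrite sumr_ge0// => i _; exact: sqr_ge0.
have IH' : (M D n ^+ 2) ^+ r.+2 <=
  2 * r.+2%:R * \sum_(i < n) (M D i ^+ 2) ^+ r.+1 * M D i * D i +
  5 * r.+2%:R ^+ 2 * (U D n.+1 ^+ r.+1 * \sum_(i < n) D i ^+ 2).
  apply: le_trans IH _; rewrite lerD2l ler_wpM2l// ler_wpM2r//.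
  by rewrite lerXn2r// nnegrE U0.
have := @tangent_ineq R r (M D n ^+ 2) (M D n.+1 ^+ 2) (U D n.+1) (sqr_ge0 _)
  (sqr_ge0 _) (MU D (leqnSn n)) (MU D (leqnn _)).
have m1 := MU D (leqnSn n); have m2 := MU D (leqnn n.+1).
move: m1 m2 IH'; rewrite MS; set m := M D n; set d := D n; set u := U D n.+1.
set A := \sum_(i < n) _; set B := u ^+ r.+1 * \sum_(i < n) _.
move=> m1 m2 IH'.
have u0 : 0 <= u by exact: U0.
have e1 : (m + d) ^+ 2 - m ^+ 2 = 2 * m * d + d ^+ 2 by ring.
rewrite {}e1.
(* The factor 5 is 4 + 1: 4 from this quadratic term, as (2m + d)^2 <= 4u, and 1 from the d^2 part
   of the tangent term, estimated in [b2]. *)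
have b1 : u ^+ r * (2 * m * d + d ^+ 2) ^+ 2 <= 4 * (u ^+ r.+1 * d ^+ 2).
  have -> : u ^+ r * (2 * m * d + d ^+ 2) ^+ 2 = u ^+ r * (m + (m + d)) ^+ 2 * d ^+ 2 by ring.
  have -> : 4 * (u ^+ r.+1 * d ^+ 2) = u ^+ r * (4 * u) * d ^+ 2 by rewrite exprSr; ring.
  rewrite ler_wpM2r ?sqr_ge0// ler_wpM2l ?exprn_ge0//.
  have : 0 <= (m - (m + d)) ^+ 2 by exact: sqr_ge0.
  move: m1 m2; nra.
have b2 : (m ^+ 2) ^+ r.+1 * d ^+ 2 <= u ^+ r.+1 * d ^+ 2.
  by rewrite ler_wpM2r ?sqr_ge0// lerXn2r// nnegrE ?sqr_ge0.
move=> H.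
have q1 : r.+2%:R <= r.+2%:R ^+ 2 :> R by rewrite -natrX ler_nat -{1}[r.+2]expn1 leq_exp2l.
have c0 : 0 <= (m ^+ 2) ^+ r.+1 * d ^+ 2 by nonneg.
have c1 : 0 <= u ^+ r.+1 * d ^+ 2 by nonneg.
have q2 : 0 <= r.+2%:R :> R by [].
have b1' := ler_wpM2l (sqr_ge0 (r.+2%:R : R)) b1.
have b2' := ler_wpM2l q2 b2.
have b3 := ler_wpM2r c1 q1.
move: H b1' b2' b3; rewrite -mulrA; lra.
Qed.

(* [doob] and [burk] combine, after two uses of Young's inequality, into a bound by
   the integral of [burk_H], whose [i]-th value depends on [D_0, ..., D_(i-1)] only. *)
Definition burk_c r : R := 2 * 8 ^+ r.+1 * (5 * r.+2%:R ^+ 2).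
Definition burk_K r : R := 2 * burk_c r * (4 * burk_c r) ^+ r.+1.
Definition burk_H D r i : R :=
  2 * ((2 * 8 ^+ r.+1) * (2 * r.+2%:R) * ((M D i ^+ 2) ^+ r.+1 * M D i)
    - 4 * (U D i ^+ r.+1 * M D i)).

Lemma max_sqr_pathwise D r n :
  runmax (fun k => (\sum_(i < k) D i) ^+ 2) n ^+ r.+2 <=
  \sum_(i < n) burk_H D r i * D i + burk_K r * (\sum_(i < n) D i ^+ 2) ^+ r.+2.
Proof.
rewrite -/(U D n).
have c0 : 0 < burk_c r by rewrite !mulr_gt0 ?exprn_gt0.
set Q := \sum_(i < n) D i ^+ 2.
have Q0 : 0 <= Q by rewrite sumr_ge0// => i _; exact: sqr_ge0.
have -> : \sum_(i < n) burk_H D r i * D i =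
  2 * ((2 * 8 ^+ r.+1) * (2 * r.+2%:R * \sum_(i < n) (M D i ^+ 2) ^+ r.+1 * M D i * D i)
    - 4 * \sum_(i < n) U D i ^+ r.+1 * M D i * D i).
  rewrite !mulr_sumr -sumrB mulr_sumr; apply: eq_bigr => i _.
  by rewrite /burk_H; ring.
have h1 := doob D r n; have h2 := burk D r n; move: h1 h2.
set A := \sum_(i < n) _; set B := \sum_(i < n) _.
rewrite -/Q => h1 h2.
(* In twice [doob], the choices 1/8 here and 1/(4 c) in [h4], with c = [burk_c r], each give back a
   quarter of U^(r+2). Half of it is absorbed, hence the leading factor 2 in [burk_H] and
   [burk_K]. *)
have h3 : U D n ^+ r.+1 * M D n ^+ 2 <=
    8^-1 * U D n ^+ r.+2 + 8 ^+ r.+1 * (M D n ^+ 2) ^+ r.+2.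
  by have := @young_pow R r.+1 (U D n) (M D n ^+ 2) 8^-1 (U0 D n) (sqr_ge0 _);
    rewrite invrK; apply; rewrite invr_gt0.
have h4 : U D n ^+ r.+1 * Q <= (4 * burk_c r)^-1 * U D n ^+ r.+2 +
    (4 * burk_c r) ^+ r.+1 * Q ^+ r.+2.
  have := @young_pow R r.+1 (U D n) Q (4 * burk_c r)^-1 (U0 D n) Q0.
  by rewrite invrK; apply; rewrite invr_gt0 mulr_gt0.
have h2' := ler_wpM2l (_ : 0 <= 2 * 8 ^+ r.+1) h2.
have {}h2' := h2' ltac:(by rewrite mulr_ge0 ?exprn_ge0).
have h4' := ler_wpM2l (ltW c0) h4.
move: h4'; rewrite mulrDr [burk_c r * (_^-1 * _)]mulrA.
have -> : burk_c r * (4 * burk_c r)^-1 = 4^-1 by rewrite invfM mulrCA divff ?mulr1// gt_eqF.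
have : burk_K r * Q ^+ r.+2 = 2 * (burk_c r * ((4 * burk_c r) ^+ r.+1 * Q ^+ r.+2)).
  by rewrite /burk_K !mulrA.
move=> -> h4'; move: h1 h2' h3.
have : burk_c r * (U D n ^+ r.+1 * Q) = 2 * 8 ^+ r.+1 * (5 * r.+2%:R ^+ 2 * (U D n ^+ r.+1 * Q)).
  by rewrite /burk_c !mulrA.
rewrite mulrDr => e; lra.
Qed.

(** Growth of order p - 1 = 2r+3 in G makes the integrand an admissible test function against a
    martingale difference in L^p. *)
Lemma burk_H_le D r i n (G : R) : (i <= n)%N -> \sum_(j < n) `|D j| <= G ->
  `|burk_H D r i| <= (8 * 8 ^+ r.+1 * r.+2%:R + 8) * G ^+ (r.*2).+3.
Proof.
move=> iN DG.
have MG k : (k <= n)%N -> `|M D k| <= G.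
  move=> kn; apply: le_trans (ler_norm_sum _ _ _) (le_trans _ DG).
  by rewrite -(subnKC kn) big_split_ord/= lerDl sumr_ge0.
have G0 : 0 <= G by apply: le_trans (MG _ iN).
have M2 k : (k <= n)%N -> M D k ^+ 2 <= G ^+ 2.
  by move=> kn; rewrite -real_normK ?num_real// lerXn2r ?nnegrE// MG.
have UG : U D i <= G ^+ 2 by apply: runmax_le => k ki; apply: M2 (leq_trans ki iN).
have G3 : G ^+ r.*2.+3 = (G ^+ 2) ^+ r.+1 * G by rewrite -exprM -exprSr mul2n doubleS.
rewrite /burk_H normrM (ger0_norm (_ : 0 <= 2))//.
apply: (@le_trans _ _ (2 * (2 * 8 ^+ r.+1 * (2 * r.+2%:R) * G ^+ r.*2.+3 + 4 * G ^+ r.*2.+3))); last first.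
  by rewrite le_eqVlt; apply/predU1P; left; ring.
rewrite ler_wpM2l// (le_trans (ler_normB _ _))// lerD//.
  rewrite normrM ger0_norm ?mulr_ge0 ?exprn_ge0//.
  rewrite ler_wpM2l ?mulr_ge0 ?exprn_ge0// G3 normrM ler_pM ?MG//.
  by rewrite normrX lerXn2r ?nnegrE ?exprn_ge0// ger0_norm ?sqr_ge0 ?M2.
rewrite normrM ger0_norm// ler_wpM2l// G3 normrM ler_pM ?MG//.
by rewrite normrX lerXn2r ?nnegrE ?exprn_ge0// ger0_norm ?U0.
Qed.

End pathwise.

(** * The dyadic recursion *)

Section recursion.
Context {R : realType}.
Variable r : nat.
Local Notation s := (r.+2 * r.+1)%N.
(** In [rec_K], 7 = 1 + 4 + 2 counts the three error terms of a doubling step. [rec_rho] is the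
    growth of an s-th root when its argument doubles. In [rec_C], 2^(r+3) pays for passing from a
    power of two to n and 2^s for splitting an s-th power of a sum. *)
Definition rec_K : R := 7 * 2 ^+ r.+2.
Definition rec_rho : R := 2 `^ s%:R^-1.
Definition rec_A : R := rec_rho * rec_K / (rec_rho - 1).
Definition rec_C : R := 2 ^+ r.+3 * 2 ^+ s * ((1 + rec_A) ^+ s + (4 * rec_K) ^+ s).
Local Notation K := rec_K.
Local Notation rho := rec_rho.

Let K1 : 1 <= K.
Proof. 
have : 1 <= 2 ^+ r.+2 :> R by rewrite exprn_ege1// ler1n.
by rewrite /rec_K; lra.
Qed.
Let s0 : s%:R != 0 :> R. Proof. by rewrite pnatr_eq0. Qed.
Let rhos : rho ^+ s = 2.
Proof. by rewrite -powR_mulrn ?powR_ge0// -powRrM mulVf// powRr1. Qed.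
Let rho1 : 1 < rho.
Proof.
rewrite ltNge; apply/negP => H; have := exprn_ile1 s (powR_ge0 _ _) H.
by rewrite rhos; lra.
Qed.
Let rho2 : rho <= 2.
Proof.
rewrite -[leRHS]rhos -[leLHS]expr1 ler_weXn2l//; exact: ltW.
Qed.
Let A0 : 0 < rec_A.
Proof.
have K0 : 0 < K by apply: lt_le_trans K1.
have r0 : 0 < rho by apply: lt_trans rho1.
by rewrite /rec_A divr_gt0 ?subr_gt0// mulr_gt0.
Qed.

Lemma exprD_ge (a b : R) n : 0 <= a -> 0 <= b -> a ^+ n.+1 + b ^+ n.+1 <= (a + b) ^+ n.+1.
Proof.
move=> a0 b0; elim: n => [//|n IH]; rewrite exprS [b ^+ _]exprS [leRHS]exprS.
apply: le_trans (ler_wpM2l (addr_ge0 a0 b0) IH).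
have := mulr_ge0 a0 (exprn_ge0 n.+1 b0); have := mulr_ge0 b0 (exprn_ge0 n.+1 a0); lra.
Qed.

(* If [w < v], take [l = w / v] and [t = l^(r+1)]; otherwise the doubling bound suffices. *)
Lemma recursion_step (x2 xm kb v w : R) : 0 < v -> 0 < w -> 0 <= xm -> xm <= v ^+ s ->
  kb <= w ^+ s -> x2 <= 2 ^+ r.+3 * xm ->
  (forall l t : R, 0 < l -> l <= 1 -> 0 < t ->
     x2 <= 2 * xm + 2 ^+ r.+2 * (l * xm + l^-1 ^+ r * (4 * t * xm + 2 * t^-1 ^+ r.+1 * kb))) ->
  x2 <= 2 * (v + K * w) ^+ s.
Proof.
move=> v0 w0 xm0 xmv kbw h1 h2.
have K0 : 0 <= K by exact: le_trans K1.
have [vw|wv] := leP v w.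
  apply: le_trans h1 _; rewrite exprS -mulrA ler_wpM2l//.
  apply: (@le_trans _ _ (2 ^+ r.+2 * w ^+ s)).
    rewrite ler_wpM2l ?exprn_ge0//; apply: le_trans xmv _.
    by rewrite lerXn2r// nnegrE ltW.
  apply: (@le_trans _ _ ((K * w) ^+ s)).
    rewrite exprMn ler_wpM2r ?exprn_ge0 ?(ltW w0)//.
    apply: (@le_trans _ _ K); first by rewrite /rec_K ler_peMl ?exprn_ge0// ler1n.
    by rewrite -[leLHS]expr1 ler_weXn2l.
  have Kw0 : 0 <= K * w by rewrite (mulr_ge0 K0)// ltW.
  by rewrite lerXn2r ?nnegrE ?addr_ge0 ?(ltW v0)// lerDr ltW.
have [u [u0 u1 wE]] : exists u, [/\ 0 < u, u <= 1 & w = u * v].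
  exists (w / v); split; [exact: divr_gt0| |by rewrite mulfVK// gt_eqF].
  by rewrite ler_pdivrMr// mul1r ltW.
apply: le_trans (h2 u (u ^+ r.+1) u0 u1 (exprn_gt0 _ u0)) _.
have vs : 0 <= v ^+ s by rewrite exprn_ge0// ltW.
have ui : 0 <= u^-1 by rewrite invr_ge0 ltW.
(* The error terms become u, 4u and 2u times v^s. In the last one the exponent of u is -r - (r+1)^2
   + s = 1, which is what determines s. *)
apply: (@le_trans _ _ (v ^+ s * (2 + 2 ^+ r.+2 * (7 * u)))).
  rewrite [leRHS]mulrDr [v ^+ s * 2]mulrC lerD ?ler_wpM2l// mulrCA ler_wpM2l ?exprn_ge0//.
  apply: (@le_trans _ _ (u * v ^+ s + u^-1 ^+ r * (4 * u ^+ r.+1 * v ^+ s + 2 * (u ^+ r.+1)^-1 ^+ r.+1 * w ^+ s))).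
    rewrite lerD// ?ler_wpM2l ?(ltW u0) ?exprn_ge0// lerD// ler_wpM2l//.
      by rewrite mulr_ge0 ?exprn_ge0// ltW.
    by rewrite mulr_ge0 ?exprn_ge0// invr_ge0 exprn_ge0// ltW.
  have e1 : u^-1 ^+ r * u ^+ r.+1 = u.
    by rewrite exprSr mulrA -exprMn mulVf ?gt_eqF// expr1n mul1r.
  have e2 : u^-1 ^+ r * ((u ^+ r.+1)^-1 ^+ r.+1 * u ^+ s) = u.
    rewrite mulSn exprD (exprM u r.+1 r.+1) (exprVn (u ^+ r.+1)).
    by rewrite [X in _ * X]mulrCA mulVf ?mulr1 ?e1// !expf_neq0// gt_eqF.
  rewrite wE exprMn le_eqVlt; apply/predU1P; left.
  move: e1 e2; set V := v ^+ s; set U := u ^+ s; set a := u^-1 ^+ r.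
  set b := u ^+ r.+1; set c := b^-1 ^+ r.+1 => e1 e2.
  transitivity (V * (u + 4 * (a * b) + 2 * (a * (c * U)))); first by ring.
  by rewrite e1 e2; ring.
rewrite wE (_ : v + K * (u * v) = v * (1 + K * u)); last by ring.
rewrite exprMn [leRHS]mulrCA ler_wpM2l//.
have K0' : 0 <= K * u by rewrite (mulr_ge0 K0)// ltW.
apply: (@le_trans _ _ (2 * (1 + K * u))); first by rewrite /rec_K; have := mulr_ge0 (exprn_ge0 r.+2 (ler0n R 2)) (ltW u0); lra.
by rewrite ler_wpM2l// -[leLHS]expr1 ler_weXn2l// lerDl.
Qed.

Let wt k : R := 1 / k%:R `^ (1 + s%:R^-1).

Let wt0 k : 0 <= wt k.
Proof. by rewrite divr_ge0 ?powR_ge0. Qed.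

Let pow2rho i : (2 ^ i)%:R `^ (1 + s%:R^-1) = 2 ^+ i * rho ^+ i :> R.
Proof.
have n2 : (2 ^ i)%:R != 0 :> R by rewrite pnatr_eq0 -lt0n expn_gt0.
rewrite powRD; last by rewrite n2 implybT.
rewrite powRr1// natrX; congr (_ * _).
rewrite -[in LHS]powR_mulrn// -powRrM mulrC powRrM powR_mulrn// powR_ge0.
Qed.

(** Over one block k^(1 + 1/s) grows at most by 2 rho <= 4. *)
Let block_weight i k : (2 ^ i <= k < 2 ^ i.+1)%N -> (4 * (2 ^+ i * rho ^+ i))^-1 <= wt k.
Proof.
move=> /andP[ik ki]; have r0 : 0 < rho by apply: lt_trans rho1.
have k0 : (0 < k)%N by apply: leq_trans ik; rewrite expn_gt0.
rewrite /wt div1r lef_pV2 ?posrE; [|by rewrite mulr_gt0// mulr_gt0// exprn_gt0|by rewrite powR_gt0// ltr0n].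
apply: (@le_trans _ _ ((2 ^ i.+1)%:R `^ (1 + s%:R^-1))).
  by apply: ge0_ler_powR; rewrite ?nnegrE ?ler0n// ler_nat ltnW.
have P0 : 0 <= 2 ^+ i * rho ^+ i by rewrite mulr_ge0 ?exprn_ge0// ltW.
rewrite pow2rho !exprS mulrACA ler_wpM2r//; move: rho2; lra.
Qed.

(** The 2^i indices of the block have weight at least (4 * 2^i * rho^i)^-1 each, so bounding every
    term below by the minimum cancels 2^i and leaves 4 rho^i. No monotonicity of [w] is required. *)
Let block_min i (w : nat -> R) : (forall k, 0 <= w k) ->
  exists k, [/\ (2 ^ i <= k)%N, (k < 2 ^ i.+1)%N &
    w k <= rho ^+ i * (4 * \sum_(2 ^ i <= j < 2 ^ i.+1) wt j * w j)].
Proof.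
move=> w0; have r0 : 0 < rho by apply: lt_trans rho1.
have i2 : (2 ^ i.+1 - 2 ^ i = 2 ^ i)%N by rewrite expnS mul2n -addnn addnK.
pose P (k : 'I_(2 ^ i.+1)) := (2 ^ i <= k)%N.
have P0 : (2 ^ i < 2 ^ i.+1)%N by rewrite ltn_exp2l.
have [k /= Pk mk] := @Order.TotalTheory.arg_minP _ R _ (Ordinal P0) P (fun k => w k) (leqnn _).
exists k; split => //.
have c0 : 0 < 4 * (2 ^+ i * rho ^+ i) by rewrite mulr_gt0// mulr_gt0// exprn_gt0.
apply: (@le_trans _ _ (rho ^+ i * (4 * \sum_(2 ^ i <= j < 2 ^ i.+1) (4 * (2 ^+ i * rho ^+ i))^-1 * w k))).
  rewrite sumr_const_nat i2 -(mulr_natl _ (2 ^ i)) natrX le_eqVlt; apply/predU1P; left.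
  by field; rewrite !expf_neq0 ?gt_eqF.
rewrite ler_wpM2l ?exprn_ge0 ?(ltW r0)// ler_wpM2l//.
apply: ler_sum_nat => j ij; apply: ler_pM => //.
- by rewrite invr_ge0 ltW.
- exact: block_weight.
- by move: ij => /andP[ij ji]; exact: (mk (Ordinal ji)).
Qed.

(** To be read with x k = E Q_k^q, [kap k] the norm of E_0(S_k^2) in L^q, and b a bound for both the
    first moment and the approximation error. *)
Lemma dyadic_recursion n (x kap : nat -> R) (b : R) : (0 < n)%N ->
  (forall k, 0 <= x k) -> (forall k, 0 <= kap k) -> 0 <= b -> x 1%N <= b ->
  (forall i j, (i <= j)%N -> (j <= i.*2)%N -> x j <= 2 ^+ r.+3 * x i) ->
  (forall m k l t, (0 < m)%N -> (m <= k)%N -> (k <= n)%N -> 0 < l -> l <= 1 -> 0 < t ->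
    x m.*2 <= 2 * x m + 2 ^+ r.+2 * (l * x m + l^-1 ^+ r *
      (4 * t * x m + 2 * t^-1 ^+ r.+1 * (kap k ^+ r.+2 + b)))) ->
  x n <= rec_C * n%:R * (b + (\sum_(1 <= k < n.+1)
    1 / k%:R `^ (1 + s%:R^-1) * kap k `^ r.+1%:R^-1) ^+ s).
Proof.
move=> n_gt0 x0 kap0 b0 x1 dbl rec.
have K0 : 0 < K by apply: lt_le_trans K1.
have r0 : 0 < rho by apply: lt_trans rho1.
pose w k := kap k `^ r.+1%:R^-1.
have w0 k : 0 <= w k by exact: powR_ge0.
have wkap k : w k ^+ s = kap k ^+ r.+2.
  rewrite mulnC exprM /w -[X in X ^+ _]powR_mulrn ?powR_ge0// -powRrM mulVf ?powRr1//.
pose W i := \sum_(1 <= k < 2 ^ i) wt k * w k.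
have W0 i : 0 <= W i by rewrite sumr_ge0// => k _; rewrite mulr_ge0.
set Wn := \sum_(1 <= k < n.+1) _.
have C0 : 0 < rec_C * n%:R.
  have A1 : 0 < 1 + rec_A by apply: addr_gt0.
  have K4 : 0 < 4 * K by apply: mulr_gt0.
  rewrite mulr_gt0 ?ltr0n//; apply: mulr_gt0; first by rewrite mulr_gt0 ?exprn_gt0.
  by apply: addr_gt0; apply: exprn_gt0.
(* [recursion_step] divides by its parameters, but b and some [w k] may vanish. Working with b' > b
   keeps them positive; b' then tends to b. *)
suff H b' : b < b' -> x n <= rec_C * n%:R * (b' + Wn ^+ s).
  apply/ler_addgt0Pr => eps eps0.
  have := H (b + eps / (rec_C * n%:R)); rewrite ltrDl divr_gt0// => /(_ isT)/le_trans; apply.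
  by rewrite addrAC mulrDr [X in _ + X]mulrCA divff ?mulr1// gt_eqF.
move=> bb'; have b'0 : 0 < b' by apply: le_lt_trans bb'.
pose be := b' `^ s%:R^-1.
have be0 : 0 < be by rewrite powR_gt0.
have bes : be ^+ s = b'.
  by rewrite -[LHS]powR_mulrn ?powR_ge0// -powRrM mulVf// powRr1// ltW.
(* [rec_A * be] is the fixed point absorbing the constant [be] added at each step,
   as [rho * K * be = (rho - 1) * (rec_A * be)]. *)
pose v i := rho ^+ i * (be + rec_A * be + 4 * K * W i) - rec_A * be.
have Ab : 0 <= rec_A * be by rewrite mulr_ge0// ltW.
have vbe i : be <= v i.
  have h1 : be + rec_A * be <= be + rec_A * be + 4 * K * W i.
    by rewrite lerDl mulr_ge0// mulr_ge0// ltW.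
  have h2 : 0 <= be + rec_A * be by rewrite addr_ge0// ltW.
  have h3 : be + rec_A * be <= rho ^+ i * (be + rec_A * be + 4 * K * W i).
    apply: (le_trans h1); rewrite ler_peMl//; first exact: le_trans h2 h1.
    by rewrite exprn_ege1// ltW.
  by rewrite /v lerBrDr.
have claim i : (2 ^ i <= n)%N -> x (2 ^ i)%N <= v i ^+ s.
  elim: i => [_|i IH iN].
    apply: le_trans x1 _; apply: (@le_trans _ _ b'); first exact: ltW.
    by rewrite -bes lerXn2r ?nnegrE ?(ltW be0)// (le_trans (ltW be0)).
  have i2 : (2 ^ i.+1 = (2 ^ i).*2)%N by rewrite expnS mul2n.
  have iN' : (2 ^ i <= n)%N by apply: leq_trans iN; rewrite leq_exp2l.
  (* This k satisfies 2^i <= k < 2^(i+1) <= n, so [rec] applies with m = 2^i. *)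
  have [k [ik ki wk]] := block_min i w0.
  have kn : (k <= n)%N by apply: leq_trans iN; exact: ltnW.
  have v0 : 0 < v i by apply: lt_le_trans be0 _.
  have wb0 : 0 < w k + be by rewrite ltr_wpDl.
  have kb : kap k ^+ r.+2 + b <= (w k + be) ^+ s.
    rewrite -wkap; apply: le_trans (exprD_ge _ (w0 k) (ltW be0)).
    by rewrite lerD2l bes ltW.
  have := recursion_step v0 wb0 (x0 (2 ^ i)%N) (IH iN') kb.
  move=> /(_ (x (2 ^ i).*2)) /(_ (dbl _ _ _ _)).
  rewrite -addnn leq_addl leqnn => /(_ isT isT) H.
  rewrite i2 -addnn; apply: le_trans (H _) _.
    move=> l t l0 l1 t0; rewrite addnn; apply: rec => //.
    by rewrite expn_gt0.
  (* Writing 2 = rho^s removes the s-th powers: what remains is the linear recursion rho (v i + K (w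
     k + be)) <= v (i+1). *)
  rewrite -{1}rhos -exprMn lerXn2r ?nnegrE//.
  - by rewrite mulr_ge0 ?ltW// ltr_wpDr// mulr_ge0 ?ltW.
  - exact: le_trans (ltW be0) (vbe _).
  have e1 : rho * K * be = rho * (rec_A * be) - rec_A * be.
    by rewrite /rec_A; field; rewrite subr_eq0 gt_eqF.
  have WS : W i.+1 = W i + \sum_(2 ^ i <= j < 2 ^ i.+1) wt j * w j.
    by rewrite /W (@big_cat_nat _ _ _ (2 ^ i))//= ?expn_gt0// leq_exp2l.
  have h : rho * K * w k <= rho * K * (rho ^+ i * (4 * \sum_(2 ^ i <= j < 2 ^ i.+1) wt j * w j)).
    by rewrite ler_wpM2l// mulr_ge0 ?ltW.
  rewrite /v WS exprS; move: h e1; set Z := \sum_(2 ^ i <= j < _) _.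
  set a := rho ^+ i; lra.
pose N := trunc_log 2 n.
have N1 : (2 ^ N <= n)%N by exact: trunc_logP.
have N2 : (n < 2 ^ N.+1)%N by exact: trunc_log_ltn.
have WN : W N <= Wn.
  rewrite /Wn (@big_cat_nat _ _ _ (2 ^ N))//= ?expn_gt0//; last exact: leqW.
  by rewrite lerDl sumr_ge0// => k _; exact: mulr_ge0 (wt0 k) (w0 k).
(* One crude doubling step reaches n from 2^N; made only once, it costs a constant and no power of
   n. *)
apply: le_trans (dbl (2 ^ N)%N n N1 _) _; first by rewrite -mul2n -expnS ltnW.
apply: (@le_trans _ _ (2 ^+ r.+3 * (rho ^+ N * (be + rec_A * be + 4 * K * Wn)) ^+ s)).
  rewrite ler_wpM2l ?exprn_ge0//; apply: le_trans (claim N N1) _.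
  have Kn : 0 <= 4 * K by rewrite mulr_ge0// ltW.
  have vN : v N <= rho ^+ N * (be + rec_A * be + 4 * K * Wn).
    rewrite /v lerBlDr; apply: (@le_trans _ _ (rho ^+ N * (be + rec_A * be + 4 * K * Wn))).
      by rewrite ler_wpM2l ?exprn_ge0 ?(ltW r0)// lerD2l ler_wpM2l.
    by rewrite lerDl.
  have v0 := le_trans (ltW be0) (vbe N).
  by rewrite lerXn2r ?nnegrE ?(le_trans v0).
(* (rho^N)^s = 2^N <= n is the source of the linear factor n. *)
rewrite exprMn exprAC rhos.
have Wn0 : 0 <= Wn by apply: le_trans WN.
have Kn : 0 <= 4 * K by rewrite mulr_ge0// ltW.
have A1 : 0 <= 1 + rec_A by rewrite addr_ge0// ltW.
set E := (_ + _) ^+ s.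
have E1 : E <= 2 ^+ s * (((1 + rec_A) * be) ^+ s + (4 * K * Wn) ^+ s).
  have eb : be + rec_A * be = (1 + rec_A) * be by ring.
  by rewrite /E eb; apply: exprD_le; apply: mulr_ge0 => //; exact: ltW.
set c1 := (1 + rec_A) ^+ s; set c2 := (4 * K) ^+ s.
have c10 : 0 <= c1 by rewrite exprn_ge0.
have c20 : 0 <= c2 by rewrite exprn_ge0.
have E2 : E <= 2 ^+ s * ((c1 + c2) * (b' + Wn ^+ s)).
  apply: le_trans E1 _; rewrite ler_wpM2l ?exprn_ge0//.
  rewrite (exprMn s (1 + rec_A) be) (exprMn s (4 * K) Wn) bes -/c1 -/c2.
  have := mulr_ge0 c10 (exprn_ge0 s Wn0); have := mulr_ge0 c20 (ltW b'0); lra.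
have N3 : 2 ^+ N <= n%:R :> R by rewrite -natrX ler_nat.
apply: (@le_trans _ _ (2 ^+ r.+3 * (n%:R * (2 ^+ s * ((c1 + c2) * (b' + Wn ^+ s)))))).
  rewrite ler_wpM2l ?exprn_ge0//; apply: ler_pM => //.
  apply: exprn_ge0; apply: addr_ge0; last exact: mulr_ge0.
  by apply: addr_ge0 => //; exact: ltW.
by rewrite le_eqVlt; apply/predU1P; left; rewrite /rec_C -/c1 -/c2; ring.
Qed.

Lemma rec_C_ge0 : 0 <= rec_C.
Proof.
have K0 : 0 <= K by exact: le_trans K1.
have A1 : 0 <= 1 + rec_A by rewrite addr_ge0// ltW.
have K4 : 0 <= 4 * K by exact: mulr_ge0.
apply: mulr_ge0; first by rewrite mulr_ge0 ?exprn_ge0.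
by apply: addr_ge0; exact: exprn_ge0.
Qed.

End recursion.

(** The first summand serves the martingale, with 2^p 6^p from separating X0 and 6 bbar. The second
    serves the remainder: 4^p for a sum of three terms, then 3 = 1 + 2 for the two theta terms and
    4^p for the terms in h_n. *)
Definition max_C {R : realType} r : R := 2 ^+ r.*2.+4 * (burk_K r * rec_C r *
  (2 ^+ r.*2.+4 * 6 ^+ r.*2.+4) + 4 ^+ r.*2.+4 * (3 + 4 ^+ r.*2.+4)).

(** * Means and norms *)

Section mean.
Context {d : measure_display} {Omega : measurableType d} {R : realType}.
Variable P : probability Omega R.
Implicit Types (f g h : Omega -> R) (c : R) (p : nat).

Definition intble f := P.-integrable setT (EFin \o f).
(** A real number, so that linear arithmetic applies; the price is that the linearity rules carry
    integrability hypotheses. *)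
Definition mean f : R := Rintegral P setT f.

Lemma intble_meas f : intble f -> measurable_fun setT f.
Proof. by move=> /integrableP[/measurable_EFinP]. Qed.

Lemma intble_dom f g : measurable_fun setT f -> (forall x, `|f x| <= g x) ->
  intble g -> intble f.
Proof.
move=> mf fg; apply: le_integrable => //; first exact/measurable_EFinP.
by move=> x _ /=; rewrite lee_fin (le_trans (fg x))// ler_norm.
Qed.

Lemma intbleD f g : intble f -> intble g -> intble (fun x => f x + g x).
Proof. by move=> If Ig; have := integrableD measurableT If Ig. Qed.

Lemma intbleZ c f : intble f -> intble (fun x => c * f x).
Proof. by move=> If; have := integrableZl measurableT c If. Qed.

Lemma intbleB f g : intble f -> intble g -> intble (fun x => f x - g x).
Proof. by move=> If Ig; have := integrableB measurableT If Ig. Qed.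

Lemma intble_cst c : intble (fun=> c).
Proof. exact: finite_measure_integrable_cst. Qed.

Lemma intble_sum (I : Type) (s : seq I) (f : I -> Omega -> R) :
  (forall i, intble (f i)) -> intble (fun x => \sum_(i <- s) f i x).
Proof.
move=> If; elim: s => [|i s IH].
  by under eq_fun do rewrite big_nil; exact: intble_cst.
by under eq_fun do rewrite big_cons; exact: intbleD.
Qed.

Lemma intble_norm f : intble f -> intble (fun x => `|f x|).
Proof. exact: integrable_norm. Qed.

Lemma eq_mean f g : f =1 g -> mean f = mean g.
Proof. by move=> fg; apply: eq_Rintegral => x _; rewrite fg. Qed.

Lemma meanD f g : intble f -> intble g ->
  mean (fun x => f x + g x) = mean f + mean g.
Proof. exact: RintegralD. Qed.

Lemma meanB f g : intble f -> intble g ->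
  mean (fun x => f x - g x) = mean f - mean g.
Proof. exact: RintegralB. Qed.

Lemma meanZ c f : intble f -> mean (fun x => c * f x) = c * mean f.
Proof. exact: RintegralZl. Qed.

Lemma mean_cst c : mean (fun=> c) = c.
Proof. by rewrite /mean Rintegral_cst// [X in fine X]probability_setT mulr1. Qed.

Lemma mean_sum (I : Type) (s : seq I) (f : I -> Omega -> R) :
  (forall i, intble (f i)) -> mean (fun x => \sum_(i <- s) f i x) = \sum_(i <- s) mean (f i).
Proof.
move=> If; elim: s => [|i s IH].
  rewrite big_nil -[RHS](mean_cst 0); apply: eq_mean => x; exact: big_nil.
rewrite big_cons -IH -meanD//; last exact: intble_sum.
by apply: eq_mean => x; rewrite big_cons.
Qed.

Lemma mean_le f g : intble f -> intble g -> (forall x, f x <= g x) -> mean f <= mean g.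
Proof. by move=> If Ig fg; apply: le_Rintegral. Qed.

Lemma mean_ge0 f : (forall x, 0 <= f x) -> 0 <= mean f.
Proof. by move=> f0; apply: Rintegral_ge0. Qed.

Lemma mean_EFin f : intble f -> (\int[P]_x (f x)%:E = (mean f)%:E)%E.
Proof. by move=> If; rewrite fineK//; exact: (integrable_fin_num measurableT If). Qed.

Definition Lpow p f := measurable_fun setT f /\ intble (fun x => `|f x| ^+ p).

Lemma Lpow_intble p f h c : Lpow p f -> measurable_fun setT h ->
  (forall x, `|h x| <= c * `|f x| ^+ p) -> intble h.
Proof. by move=> [_ If] mh hf; apply: (intble_dom mh hf); exact: intbleZ. Qed.

Lemma Lpow_dom p f h c : Lpow p f -> measurable_fun setT h ->
  (forall x, `|h x| <= c * `|f x|) -> Lpow p h.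
Proof.
move=> pf mh hf; split => //; apply: (@Lpow_intble p f _ (c ^+ p)) => //.
  by apply: measurable_funX; exact: measurableT_comp.
move=> x; rewrite normrX normr_id -exprMn lerXn2r// nnegrE//.
exact: le_trans (hf x).
Qed.

Lemma Lpow_norm p f : Lpow p f -> Lpow p (fun x => `|f x|).
Proof.
move=> pf; apply: (@Lpow_dom p f _ 1) => //; last by move=> x; rewrite normr_id mul1r.
by case: pf => mf _; exact: measurableT_comp.
Qed.

Lemma LpowD p f g : Lpow p f -> Lpow p g -> Lpow p (fun x => f x + g x).
Proof.
move=> [mf If] [mg Ig]; have mfg := measurable_funD mf mg.
split => //; apply: intble_dom (intbleZ (2 ^+ p) (intbleD If Ig)).
  by apply: measurable_funX; exact: measurableT_comp.
move=> x; rewrite normrX normr_id; apply: le_trans (exprD_le _ (normr_ge0 _) (normr_ge0 _)).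
by rewrite lerXn2r ?nnegrE ?addr_ge0// ler_normD.
Qed.

Lemma LpowZ p c f : Lpow p f -> Lpow p (fun x => c * f x).
Proof.
move=> pf; apply: (@Lpow_dom p f _ `|c|) => //; last by move=> x; rewrite normrM.
by case: pf => mf _; exact: measurable_funM.
Qed.

Lemma LpowB p f g : Lpow p f -> Lpow p g -> Lpow p (fun x => f x - g x).
Proof.
move=> pf /(LpowZ (-1)) pg; have := LpowD pf pg.
by under eq_fun do rewrite mulN1r.
Qed.

Lemma Lpow_cst p c : Lpow p (fun=> c).
Proof. by split; [exact: measurable_cst | exact: intble_cst]. Qed.

Lemma Lpow_sum p (I : Type) (s : seq I) (f : I -> Omega -> R) :
  (forall i, Lpow p (f i)) -> Lpow p (fun x => \sum_(i <- s) f i x).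
Proof.
move=> pf; elim: s => [|i s IH].
  by under eq_fun do rewrite big_nil; exact: Lpow_cst.
by under eq_fun do rewrite big_cons; exact: LpowD.
Qed.

Lemma Lpow1 f : intble f <-> Lpow 1 f.
Proof.
split=> [If|[mf If]].
  by split; [exact: intble_meas | exact: intble_norm].
by apply: (intble_dom mf _ If) => x; rewrite expr1.
Qed.

(** Hölder's inequality without conjugate exponents: Young's inequality with t = 1 gives an
    integrable majorant pointwise. *)
Lemma Lpow_mul p f h g c : Lpow p.+1 f -> Lpow p.+1 g -> measurable_fun setT h ->
  (forall x, `|h x| <= c * `|f x| ^+ p) -> intble (fun x => h x * g x).
Proof.
move=> [_ If] [mg Ig] mh hf.
apply: (@intble_dom _ (fun x => `|c| * (`|f x| ^+ p.+1 + `|g x| ^+ p.+1))); last first.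
- exact/intbleZ/intbleD.
- move=> x; rewrite normrM (le_trans (ler_wpM2r (normr_ge0 _) (hf x)))//.
  rewrite (@le_trans _ _ (`|c| * `|f x| ^+ p * `|g x|))//.
    by rewrite ler_wpM2r// ler_wpM2r ?exprn_ge0// ler_norm.
  rewrite -mulrA ler_wpM2l//.
  have := @young_pow R p `|f x| `|g x| 1 (normr_ge0 _) (normr_ge0 _) ltr01.
  by rewrite invr1 expr1n !mul1r.
- exact: measurable_funM.
Qed.

Lemma Lpow_le p q f : (p <= q)%N -> Lpow q f -> Lpow p f.
Proof.
move=> pq [mf If]; split => //.
apply: intble_dom (intbleD (intble_cst 1) If).
  by apply: measurable_funX; exact: measurableT_comp.
move=> x; rewrite ger0_norm ?exprn_ge0//; have [f1|f1] := leP `|f x| 1.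
  by rewrite (le_trans (exprn_ile1 p (normr_ge0 (f x)) f1))// lerDl exprn_ge0.
by rewrite (le_trans (ler_weXn2l (ltW f1) pq))// lerDr.
Qed.

Lemma Lpow_sqr p f : Lpow p.*2 f -> Lpow p (fun x => f x ^+ 2).
Proof.
move=> [mf If]; split; first exact: measurable_funX.
rewrite (_ : (fun x => _) = (fun x => `|f x| ^+ p.*2))//.
by apply/funext => x; rewrite normrX -exprM mul2n.
Qed.

End mean.

(** * Norms in L^p as real numbers *)

Section norms.
Context {d : measure_display} {Omega : measurableType d} {R : realType}.
Variable P : probability Omega R.
Implicit Types (f g h : Omega -> R) (c : R) (p : nat).
Local Notation mean := (mean P).
Local Notation Lpow := (Lpow P).
Local Notation "''N_' p [ f ]" := ('N[P]_(p%:R%:E)[EFin \o f])%E.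

Lemma integral_pow p f : (0 < p)%N ->
  ('N_p[f] `^ p%:R = \int[P]_x ((`|f x| ^+ p)%:E))%E.
Proof.
move=> p0; rewrite poweR_Lnorm ?pnatr_eq0 -?lt0n//.
apply: eq_integral => x _ /=; congr (_%:E).
by rewrite powR_mulrn.
Qed.

Lemma Lfun_Lpow p f : (0 < p)%N -> f \in Lfun P p%:R%:E -> Lpow p f.
Proof.
move=> p0 Lf; have := Lfun_integrable _ Lf; rewrite ler1n => /(_ p0) I; split.
  exact: set_mem (sub_Lfun_mfun Lf).
by move: I; under eq_fun do rewrite powR_mulrn//.
Qed.

Definition nrm p f : R := fine 'N_p[f].

Lemma Lnorm_nrm p f : (0 < p)%N -> Lpow p f -> 'N_p[f]%E = (nrm p f)%:E.
Proof.
move=> p0 [mf If]; rewrite fineK// ge0_fin_numE ?Lnorm_ge0//.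
apply: (@lty_poweRy _ _ p%:R); first by rewrite pnatr_eq0 -lt0n.
by rewrite integral_pow//; have := mean_EFin If => /= ->; rewrite ltry.
Qed.

Lemma nrm_ge0 p f : 0 <= nrm p f.
Proof. by rewrite fine_ge0 ?Lnorm_ge0. Qed.

Lemma mean_nrm p f : (0 < p)%N -> Lpow p f -> mean (fun x => `|f x| ^+ p) = nrm p f ^+ p.
Proof.
move=> p0 pf; apply: EFin_inj; have [_ If] := pf.
rewrite -mean_EFin// -integral_pow// Lnorm_nrm// poweR_EFin.
by rewrite powR_mulrn// nrm_ge0.
Qed.

Lemma nrm_le p f c : (0 < p)%N -> Lpow p f -> 0 <= c ->
  mean (fun x => `|f x| ^+ p) <= c ^+ p -> nrm p f <= c.
Proof. by move=> p0 pf c0; rewrite mean_nrm// ler_pXn2r// nnegrE nrm_ge0. Qed.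

Lemma nrmD p f g : (0 < p)%N -> Lpow p f -> Lpow p g ->
  nrm p (fun x => f x + g x) <= nrm p f + nrm p g.
Proof.
move=> p0 pf pg; rewrite -lee_fin EFinD -!Lnorm_nrm//; last exact: LpowD.
by apply: minkowski_EFin; [case: pf | case: pg | rewrite ler1n].
Qed.

Lemma nrmZ p c f : (0 < p)%N -> Lpow p f ->
  nrm p (fun x => c * f x) = `|c| * nrm p f.
Proof.
move=> p0 pf; apply: (pexpIrn p0); rewrite ?nnegrE ?mulr_ge0 ?nrm_ge0//.
rewrite exprMn -!mean_nrm//; last exact: LpowZ.
rewrite -meanZ; last by case: pf.
by apply: eq_mean => x; rewrite normrM exprMn.
Qed.

Lemma nrmN p f : (0 < p)%N -> Lpow p f -> nrm p (fun x => - f x) = nrm p f.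
Proof.
move=> p0 pf; rewrite -[RHS]mul1r -(normrN1 R) -nrmZ//.
by congr (nrm _ _); apply/funext => x; rewrite mulN1r.
Qed.

Lemma nrmB p f g : (0 < p)%N -> Lpow p f -> Lpow p g ->
  nrm p (fun x => f x - g x) <= nrm p f + nrm p g.
Proof.
move=> p0 pf pg; rewrite -(@nrmN p g)//; apply: nrmD => //.
by have := LpowZ (-1) pg; under eq_fun do rewrite mulN1r.
Qed.

Lemma nrm_cst0 p : (0 < p)%N -> nrm p (fun=> 0) = 0.
Proof.
move=> p0; apply: (pexpIrn p0); rewrite ?nnegrE ?nrm_ge0//.
rewrite -mean_nrm//; last exact: Lpow_cst.
by rewrite normr0 mean_cst.
Qed.

Lemma nrm_sum p (I : Type) (s : seq I) (f : I -> Omega -> R) : (0 < p)%N ->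
  (forall i, Lpow p (f i)) ->
  nrm p (fun x => \sum_(i <- s) f i x) <= \sum_(i <- s) nrm p (f i).
Proof.
move=> p0 pf; elim: s => [|i s IH].
  by under eq_fun do rewrite big_nil; rewrite nrm_cst0// big_nil.
under eq_fun do rewrite big_cons.
rewrite big_cons (le_trans (nrmD _ _ _))// ?lerD2l//; exact: Lpow_sum.
Qed.

End norms.

(** * Conditional expectations *)

Section conditional.
Context {d : measure_display} {Omega : measurableType d} {R : realType}.
Variables (P : probability Omega R) (F : set (set Omega)).
Hypotheses (sF : sigma_algebra setT F) (Fm : F `<=` measurable).
Implicit Types (f g h W Y Z : Omega -> R) (c : R) (p : nat).
Local Notation mean := (mean P).
Local Notation Lpow := (Lpow P).
Local Notation intble := (intble P).
Local Notation nrm := (nrm P).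

Lemma sub_sigmaE (A : set (g_sigma_algebraType F)) : measurable A = F A.
Proof. by rewrite -[in RHS](sigma_algebra_id sF). Qed.

(** Regarding F as the measurable structure of a new type makes the usual closure properties of
    measurable functions available for F. *)
Lemma measurable_wrtP f :
  measurable_wrt F f <-> measurable_fun setT (f : g_sigma_algebraType F -> R).
Proof.
split=> [mf _ B mB|mf B mB]; first by rewrite setTI sub_sigmaE; exact: mf.
by rewrite -sub_sigmaE -[X in measurable X]setTI; exact: mf.
Qed.

Lemma measurable_wrt_sub f : measurable_wrt F f -> measurable_fun setT f.
Proof. by move=> mf _ B mB; rewrite setTI; apply/Fm/mf. Qed.

Lemma mean_indic_mul (A : set Omega) W : measurable A -> intble W ->
  mean (fun x => \1_A x * W x) = fine (\int[P]_(x in A) (W x)%:E)%E.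
Proof.
move=> mA IW; rewrite integral_mkcond; congr fine; apply: eq_integral => x _.
by rewrite /= patchE indicE; case: ifPn => _; rewrite ?mul1r ?mul0r.
Qed.

Let test_ge0 W f : intble W ->
  (forall A, F A -> (\int[P]_(x in A) (W x)%:E = 0)%E) ->
  measurable_wrt F f -> (forall x, 0 <= f x) ->
  intble (fun x => f x * W x) -> mean (fun x => f x * W x) = 0.
Proof.
move=> IW W0 mf f0 IfW.
have mEf : measurable_fun [set: g_sigma_algebraType F] (EFin \o f).
  by apply/measurable_EFinP/measurable_wrtP.
have mW := intble_meas IW.
pose g := nnsfun_approx measurableT mEf.
have gf x : (g n x)%:E @[n --> \oo] --> (f x)%:E.
  have f0' t : setT t -> (0 <= (EFin \o f) t)%E by rewrite /= lee_fin.
  exact: (@cvg_nnsfun_approx _ _ _ _ measurableT _ mEf f0' x Logic.I).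
have g0 n x : 0 <= g n x by exact: fun_ge0.
have gle n x : g n x <= f x.
  have nd : nondecreasing_seq (fun n => g n x).
    by move=> a b ab; exact/lefP/nd_nnsfun_approx.
  have gfx : (fun n => g n x) @ \oo --> f x by exact: fine_cvg (gf x).
  rewrite -(cvg_lim _ gfx)//; apply: nondecreasing_cvgn_le => //.
  by apply/cvg_ex; exists (f x).
have Fg n y : F (g n @^-1` [set y]).
  by rewrite -sub_sigmaE -[X in measurable X]setTI; apply: measurable_funP.
have gW0 n : intble (fun x => g n x * W x) /\ mean (fun x => g n x * W x) = 0.
  (* The level sets of the simple function lie in F, where the integral of W vanishes; dominated
     convergence, with majorant |f W|, then passes to f. *)
  have E : (fun x => g n x * W x) = (fun x =>
     \sum_(y <- fset_set (range (g n))) (y * (\1_(g n @^-1` [set y]) x * W x))).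
    apply/funext => x; rewrite (fimfunE (g n)) (fsbig_finite _ _ (fimfunP (g n))) mulr_suml/=.
    by apply: eq_bigr => y _; rewrite mulrA.
  have I1 y : intble (fun x => \1_(g n @^-1` [set y]) x * W x).
    apply: intble_dom (intble_norm IW).
      by apply: measurable_funM => //; exact/measurable_indic/Fm.
    move=> x; rewrite normrM indicE ler_piMl// normr_nat.
    by case: (_ \in _).
  rewrite E; split; first by apply: intble_sum => y; exact: intbleZ.
  rewrite mean_sum; last by move=> y; exact: intbleZ.
  rewrite big1// => y _; rewrite meanZ// mean_indic_mul//; last exact: Fm.
  by rewrite W0//= mulr0.
have IE n : (\int[P]_x (g n x * W x)%:E = 0)%E.
  by have [IgW gW] := gW0 n; rewrite (mean_EFin IgW) gW.
have H := @dominated_cvg _ _ _ P setT measurableT (fun n (x : Omega) => (g n x * W x)%:E)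
   (fun x => (f x * W x)%:E) (fun x => `|f x * W x|%:E).
have {}H : (fun n => (\int[P]_x (g n x * W x)%:E)%E) @ \oo --> (mean (fun x => f x * W x))%:E.
  rewrite -mean_EFin//.
  apply: H.
  - by move=> n; apply/measurable_EFinP; apply: intble_meas (gW0 n).1.
  - move=> x _; under eq_fun do rewrite EFinM.
    rewrite EFinM; apply: cvgeM => //; exact: cvg_cst.
  - by [].
  - exact: intble_norm.
  - move=> n x _ /=; rewrite lee_fin !normrM ler_wpM2r//.
    by rewrite !ger0_norm.
rewrite (funext IE) in H; apply: EFin_inj; apply: (cvg_unique _ H) => //.
exact: cvg_cst.
Qed.

(* Splitting [f = (f + |f|) - |f|] reduces to nonnegative [f], which are limits
   of [F]-simple functions. *)
Lemma mean_test0 W f : intble W ->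
  (forall A, F A -> (\int[P]_(x in A) (W x)%:E = 0)%E) ->
  measurable_wrt F f -> intble (fun x => f x * W x) ->
  mean (fun x => f x * W x) = 0.
Proof.
move=> IW W0 mf IfW.
have mf' := measurable_wrt_sub mf; have mW := intble_meas IW.
have mnf : measurable_wrt F (fun x => `|f x|).
  by apply/measurable_wrtP; apply: measurableT_comp => //; exact/measurable_wrtP.
have mpf : measurable_wrt F (fun x => f x + `|f x|).
  by apply/measurable_wrtP; apply: measurable_funD; exact/measurable_wrtP.
have InfW : intble (fun x => `|f x| * W x).
  apply: intble_dom (intble_norm IfW).
    by apply: measurable_funM => //; exact: measurableT_comp.
  by move=> x; rewrite !normrM normr_id.
have IpfW : intble (fun x => (f x + `|f x|) * W x).
  by under eq_fun do rewrite mulrDl; exact: intbleD.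
have -> : mean (fun x => f x * W x) =
    mean (fun x => (f x + `|f x|) * W x) - mean (fun x => `|f x| * W x).
  by rewrite -meanB//; apply: eq_mean => x; rewrite mulrDl addrK.
rewrite !test_ge0 ?subrr// => x; rewrite -lerBlDr sub0r.
by rewrite lerNl -normrN ler_norm.
Qed.

Lemma mean_condexp Y f : intble Y -> measurable_wrt F f ->
  intble (fun x => f x * Y x) -> intble (fun x => f x * condexp P F Y x) ->
  mean (fun x => f x * condexp P F Y x) = mean (fun x => f x * Y x).
Proof.
move=> IY mf IfY IfZ; have [mZ IZ YZ] := condexpP sF Fm IY.
apply/eqP; rewrite -subr_eq0 -meanB//; apply/eqP.
under eq_fun do rewrite -mulrBr.
apply: mean_test0 => //.
- exact: intbleB.
- move=> A FA; rewrite integralB_EFin//; [|exact: Fm|..].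
  + rewrite YZ// subee//; apply: integrable_fin_num; first exact: Fm.
    by apply: integrableS IY => //; exact: Fm.
  + by apply: integrableS IZ => //; exact: Fm.
  + by apply: integrableS IY => //; exact: Fm.
- by under eq_fun do rewrite mulrBr; exact: intbleB.
Qed.

(* Testing against the truncations [u |u|^k] of [h |h|^k], Young's inequality
   absorbs half of the left-hand side. *)
Lemma Lpow_conditional k h Y : measurable_wrt F h -> intble h -> Lpow k.+2 Y ->
  (forall f, measurable_wrt F f -> (exists c, forall x, `|f x| <= c) ->
     mean (fun x => f x * h x) = mean (fun x => f x * Y x)) ->
  Lpow k.+2 h /\ nrm k.+2 h <= 2 * nrm k.+2 Y.
Proof.
move=> mh Ih pY hY; have mh' := measurable_wrt_sub mh.
(* Absorption needs a finite left-hand side, and |h|^(k+2) is not yet known to be integrable; hence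
   the truncation. *)
pose u (n : nat) x := Num.max (- n%:R) (Num.min (h x) n%:R) : R.
have mu n : measurable_wrt F (u n).
  apply/measurable_wrtP; apply: measurable_maxr; first exact: measurable_cst.
  by apply: measurable_minr => //; exact/measurable_wrtP.
have un n x : `|u n x| <= n%:R.
  rewrite /u; have : 0 <= n%:R :> R by [].
  by case: (leP (h x)) => ?; case: (leP (- n%:R)) => ?; rewrite ?normrN ler_norml; lra.
have uh n x : u n x ^+ 2 <= u n x * h x.
  rewrite /u; have : 0 <= n%:R :> R by [].
  by case: (leP (h x)) => ?; case: (leP (- n%:R)) => ?; nra.
have bnd n : mean (fun x => `|u n x| ^+ k.+2) <= 2 ^+ k.+2 * mean (fun x => `|Y x| ^+ k.+2).
  pose f x := u n x * `|u n x| ^+ k.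
  have mf : measurable_wrt F f.
    apply/measurable_wrtP; apply: measurable_funM; first exact/measurable_wrtP.
    by apply: measurable_funX; apply: measurableT_comp => //; exact/measurable_wrtP.
  have fn x : `|f x| <= n%:R ^+ k.+1.
    by rewrite normrM normrX normr_id -exprS lerXn2r ?nnegrE.
  have bI g : intble g -> intble (fun x => f x * g x).
    move=> Ig; apply: intble_dom (intbleZ (n%:R ^+ k.+1) (intble_norm Ig)).
      by apply: measurable_funM; [exact: measurable_wrt_sub | exact: intble_meas Ig].
    by move=> x; rewrite normrM ler_wpM2r.
  have IY : intble Y by apply/Lpow1; exact: Lpow_le pY.
  have IYp : intble (fun x => `|Y x| ^+ k.+2) by case: pY.
  have Iu : intble (fun x => `|u n x| ^+ k.+2).
    apply: intble_dom (intble_cst _ (n%:R ^+ k.+2)).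
      by apply: measurable_funX; apply: measurableT_comp => //; exact: measurable_wrt_sub.
    by move=> x; rewrite normrX normr_id lerXn2r ?nnegrE.
  have h1 : mean (fun x => `|u n x| ^+ k.+2) <= mean (fun x => f x * Y x).
    rewrite -hY//; last by exists (n%:R ^+ k.+1).
    apply: mean_le => //; first exact: bI.
    move=> x; rewrite /f mulrAC 2!exprS mulrA -expr2 real_normK ?num_real//.
    by rewrite ler_wpM2r ?exprn_ge0.
  (* Young's inequality with t = 1/2: after absorption the constant is 2^(k+2), that is a factor 2
     for the norms. *)
  have h2 : mean (fun x => f x * Y x) <=
      mean (fun x => 2^-1 * `|u n x| ^+ k.+2 + 2 ^+ k.+1 * `|Y x| ^+ k.+2).
    apply: mean_le; [exact: bI | by apply: intbleD; exact: intbleZ|].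
    move=> x; apply: le_trans (ler_norm _) _.
    rewrite 2!normrM normrX normr_id -exprS.
    have := @young_pow R k.+1 `|u n x| `|Y x| 2^-1 (normr_ge0 _) (normr_ge0 _).
    by rewrite invrK; apply; rewrite invr_gt0.
  move: h2; rewrite meanD ?meanZ//; [|exact: intbleZ|exact: intbleZ].
  rewrite [2 ^+ k.+2]exprS -[2 * _ * _]mulrA; lra.
have Eh x : `|u n x| ^+ k.+2 @[n --> \oo] --> `|h x| ^+ k.+2.
  apply: cvg_near_cst; exists (Num.bound `|h x|) => // n /= hn.
  have : `|h x| <= n%:R.
    apply: ltW; apply: lt_le_trans (archi_boundP (normr_ge0 _)) _.
    by rewrite ler_nat.
  rewrite ler_norml => /andP[h1 h2].
  by rewrite /u min_l// max_r.
have IYp : intble (fun x => `|Y x| ^+ k.+2) by case: pY.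
have mnh n : measurable_fun setT (fun x => (`|u n x| ^+ k.+2)%:E).
  apply/measurable_EFinP; apply: measurable_funX; apply: measurableT_comp => //.
  exact: measurable_wrt_sub.
(* Fatou's lemma: u n x = h x as soon as n >= |h x|. *)
have H : (\int[P]_x (`|h x| ^+ k.+2)%:E <=
    (2 ^+ k.+2 * mean (fun x => `|Y x| ^+ k.+2))%:E)%E.
  have := @fatou _ _ _ P setT measurableT (fun n x => (`|u n x| ^+ k.+2)%:E).
  move=> /(_ mnh).
  have -> : (fun x => limn_einf (fun n => (`|u n x| ^+ k.+2)%:E)) =
      (fun x => (`|h x| ^+ k.+2)%:E).
    apply/funext => x; apply: (fst (cvg_limn_einf_sup _)); apply: cvg_EFin => //.
      by apply: nearW.
    exact: Eh.
  move=> Hf; apply: le_trans (Hf _) _; first by move=> n x _; rewrite lee_fin exprn_ge0.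
  rewrite limn_einf_lim; apply: lime_le => //.
    exact: is_cvg_einfs.
  apply: nearW => n; apply: le_trans (ereal_inf_lbound _) _; first by exists n => /=.
  rewrite mean_EFin ?lee_fin//.
  apply: intble_dom (intble_cst _ (n%:R ^+ k.+2)).
    by have /measurable_EFinP := mnh n.
  by move=> x; rewrite normrX normr_id lerXn2r ?nnegrE.
have ph : Lpow k.+2 h.
  split => //; apply/integrableP; split.
    by apply/measurable_EFinP; apply: measurable_funX; exact: measurableT_comp.
  rewrite (le_lt_trans _ (ltry (2 ^+ k.+2 * mean (fun x => `|Y x| ^+ k.+2))))//.
  rewrite (le_trans _ H)// le_eqVlt; apply/predU1P; left; apply: eq_integral => x _.
  by rewrite /= normrX normr_id.
split => //; apply: nrm_le => //; first by rewrite mulr_ge0// nrm_ge0.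
rewrite exprMn -mean_nrm// -lee_fin -mean_EFin//; by case: ph.
Qed.


End conditional.

(** * Stationary sequences *)

Section measure_preserving.
Context {d : measure_display} {Omega : measurableType d} {R : realType}.
Variables (P : probability Omega R) (T : Omega -> Omega).
Hypothesis mT : measurable_fun [set: Omega] T.
Hypothesis TP : forall A : set Omega, measurable A -> P (T @^-1` A) = P A.
Implicit Types (f : Omega -> R) (p j : nat).
Local Notation mean := (mean P).
Local Notation Lpow := (Lpow P).
Local Notation intble := (intble P).
Local Notation nrm := (nrm P).

Let pushT (f : Omega -> \bar R) :
  (\int[pushforward P T]_x f x = \int[P]_x f x)%E.
Proof. by apply: eq_measure_integral => A mA _; exact: TP. Qed.

Lemma intble_shift f : intble f -> intble (f \o T).
Proof.
move=> /integrableP[mf If]; apply/integrableP; split.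
  by have := measurableT_comp mf mT.
move: If; rewrite -pushT ge0_integral_pushforward//.
exact: measurableT_comp.
Qed.

Lemma mean_shift f : intble f -> mean (f \o T) = mean f.
Proof.
move=> If; congr fine; rewrite -[RHS]pushT integral_pushforward//.
- by apply/measurable_EFinP; exact: intble_meas If.
- exact: intble_shift.
Qed.

Lemma comp_iterS f j : f \o iter j.+1 T = (f \o iter j T) \o T.
Proof. by apply/funext => x; rewrite /= -iterSr. Qed.

Lemma intble_iter f j : intble f -> intble (f \o iter j T).
Proof. by move=> If; elim: j => [//|j IH]; rewrite comp_iterS; exact: intble_shift. Qed.

Lemma mean_iter f j : intble f -> mean (f \o iter j T) = mean f.
Proof.
by move=> If; elim: j => [//|j IH]; rewrite comp_iterS mean_shift ?IH//; exact: intble_iter.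
Qed.

Lemma measurable_iter j : measurable_fun setT (iter j T).
Proof. by elim: j => [|j IH]; [exact: measurable_id | exact: measurableT_comp mT IH]. Qed.

Lemma Lpow_iter p f j : Lpow p f -> Lpow p (f \o iter j T).
Proof.
move=> [mf If]; split; first exact: measurableT_comp (measurable_iter j).
exact: (@intble_iter (fun x => `|f x| ^+ p)).
Qed.

Lemma nrm_iter p f j : (0 < p)%N -> Lpow p f -> nrm p (f \o iter j T) = nrm p f.
Proof.
move=> p0 pf; apply: (pexpIrn p0); rewrite ?nnegrE ?nrm_ge0//.
rewrite -!mean_nrm//; last exact: Lpow_iter.
by apply: (@mean_iter (fun x => `|f x| ^+ p)); case: pf.
Qed.

End measure_preserving.

(** * The filtration of the shift and orthogonality to the past *)

Section dynamics.
Context {d : measure_display} {Omega : measurableType d} {R : realType}.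
Variables (P : probability Omega R) (T Tinv : Omega -> Omega).
Hypotheses (TK : cancel T Tinv) (TinvK : cancel Tinv T).
Hypotheses (mT : measurable_fun [set: Omega] T) (mTinv : measurable_fun [set: Omega] Tinv).
Hypothesis TP : forall A : set Omega, measurable A -> P (T @^-1` A) = P A.
Variable F0 : set (set Omega).
Hypotheses (sF0 : sigma_algebra [set: Omega] F0) (F0m : F0 `<=` measurable).
Hypothesis F0T : F0 `<=` preimage_set_system [set: Omega] T F0.
Implicit Types (f g h Y Z A G H : Omega -> R) (c : R) (p m i j n : nat).
Local Notation mean := (mean P).
Local Notation Lpow := (Lpow P).
Local Notation intble := (intble P).
Local Notation nrm := (nrm P).
Local Notation E0 := (condexp P F0).

Let TinvP (A : set Omega) : measurable A -> P (Tinv @^-1` A) = P A.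
Proof.
move=> mA; rewrite -TP; last by rewrite -[X in measurable X]setTI; exact: mTinv.
by congr (P _); apply/seteqP; split => x; rewrite /= TK.
Qed.

(** Measurability with respect to F_j = T^-j(F0), expressed through F0 so that one sigma-algebra
    suffices. *)
Definition adapted j f := measurable_wrt F0 (f \o iter j Tinv).

(** The filtration increases: here the inclusion of F0 in T^-1(F0) enters. *)
Lemma adaptedS j f : adapted j f -> adapted j.+1 f.
Proof.
move=> mf B mB; have /F0T[C FC CE] := mf B mB.
rewrite (_ : _ @^-1` B = C)//; apply/seteqP; split => x.
  rewrite /= -iterS iterSr => Bx.
  have : ((f \o iter j Tinv) @^-1` B) (Tinv x) by [].
  by rewrite -CE => -[_ /=]; rewrite TinvK.
move=> Cx; rewrite /= -iterS iterSr.
suff : ((f \o iter j Tinv) @^-1` B) (Tinv x) by [].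
by rewrite -CE; split => //=; rewrite TinvK.
Qed.

Lemma adapted_le i j f : (i <= j)%N -> adapted i f -> adapted j f.
Proof.
by move=> /subnKC <-; elim: (j - i)%N => [|k IH]; rewrite ?addn0// addnS => /IH/adaptedS.
Qed.

Lemma iterTK j x : iter j T (iter j Tinv x) = x.
Proof. by elim: j x => [//|j IH] x; rewrite iterSr iterS TinvK IH. Qed.

Lemma iterTinvK j x : iter j Tinv (iter j T x) = x.
Proof. by elim: j x => [//|j IH] x; rewrite iterSr iterS TK IH. Qed.

Lemma adapted_iter j f : measurable_wrt F0 f -> adapted j (f \o iter j T).
Proof.
move=> mf; rewrite /adapted (_ : _ \o _ = f)//.
by apply/funext => x /=; rewrite iterTK.
Qed.

Lemma adaptedP j f :
  adapted j f <-> measurable_fun setT (f \o iter j Tinv : g_sigma_algebraType F0 -> R).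
Proof. exact: measurable_wrtP. Qed.

Lemma adaptedD j f g : adapted j f -> adapted j g -> adapted j (fun x => f x + g x).
Proof. by move=> /adaptedP mf /adaptedP mg; apply/adaptedP; exact: measurable_funD mf mg. Qed.

Lemma adaptedB j f g : adapted j f -> adapted j g -> adapted j (fun x => f x - g x).
Proof. by move=> /adaptedP mf /adaptedP mg; apply/adaptedP; exact: measurable_funB mf mg. Qed.

Lemma adaptedM j f g : adapted j f -> adapted j g -> adapted j (fun x => f x * g x).
Proof. by move=> /adaptedP mf /adaptedP mg; apply/adaptedP; exact: measurable_funM mf mg. Qed.

Lemma adapted_cst j c : adapted j (fun=> c).
Proof. by apply/adaptedP; exact: measurable_cst. Qed.

Lemma adaptedX j f n : adapted j f -> adapted j (fun x => f x ^+ n).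
Proof. by move=> /adaptedP mf; apply/adaptedP; have := measurable_funX n mf. Qed.

Lemma adapted_max j f g : adapted j f -> adapted j g -> adapted j (fun x => Num.max (f x) (g x)).
Proof. by move=> /adaptedP mf /adaptedP mg; apply/adaptedP; exact: measurable_maxr mf mg. Qed.

Lemma adapted_sum j (I : Type) (s : seq I) (f : I -> Omega -> R) :
  (forall k : I, adapted j (f k)) -> adapted j (fun x => \sum_(k <- s) f k x).
Proof.
move=> mf; elim: s => [|i s IH].
  by under eq_fun do rewrite big_nil; exact: adapted_cst.
by under eq_fun do rewrite big_cons; exact: adaptedD.
Qed.

Lemma adapted_runmax j n (f : nat -> Omega -> R) : (forall i, (i <= n)%N -> adapted j (f i)) ->
  adapted j (fun x => runmax (f^~ x) n).
Proof.
elim: n => [|n IH] mf; first exact: (mf 0%N).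
by apply: adapted_max; [apply: IH => i /leqW/mf | exact: mf].
Qed.

Lemma adapted_meas j f : adapted j f -> measurable_fun setT f.
Proof.
move=> /(measurable_wrt_sub F0m) mf.
rewrite (_ : f = (f \o iter j Tinv) \o iter j T).
  exact: measurableT_comp mf (measurable_iter mT j).
by apply/funext => x /=; rewrite iterTinvK.
Qed.

(* [orth m Y]: [Y] is in [L^(m+1)] and [E(Y | F0) = 0], tested against the
   [F0]-measurable functions of order [m]. *)
Definition orth m Y := Lpow m.+1 Y /\ forall A c G, measurable_wrt F0 A -> Lpow m.+1 G ->
  (forall x, `|A x| <= c * `|G x| ^+ m) -> mean (fun x => A x * Y x) = 0.

Lemma orthD m Y Z : orth m Y -> orth m Z -> orth m (fun x => Y x + Z x).
Proof.
move=> [pY Y0] [pZ Z0]; split => [|A c G mA pG AG]; first exact: LpowD.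
have mA' := measurable_wrt_sub F0m mA.
under eq_fun do rewrite mulrDr.
by rewrite meanD ?(Y0 _ _ _ mA pG AG) ?(Z0 _ _ _ mA pG AG) ?addr0//;
  exact: (Lpow_mul pG _ mA' AG).
Qed.

Lemma orthZ m c Y : orth m Y -> orth m (fun x => c * Y x).
Proof.
move=> [pY Y0]; split => [|A b G mA pG AG]; first exact: LpowZ.
have mA' := measurable_wrt_sub F0m mA.
under eq_fun do rewrite mulrCA.
by rewrite meanZ ?(Y0 _ _ _ mA pG AG) ?mulr0//; exact: (Lpow_mul pG pY mA' AG).
Qed.

Lemma orthB m Y Z : orth m Y -> orth m Z -> orth m (fun x => Y x - Z x).
Proof.
move=> oY /(orthZ (-1)) oZ; have := orthD oY oZ.
by under eq_fun do rewrite mulN1r.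
Qed.

Lemma orth_sum m (I : Type) (s : seq I) (Y : I -> Omega -> R) :
  (forall k : I, orth m (Y k)) -> orth m (fun x => \sum_(k <- s) Y k x).
Proof.
move=> oY; elim: s => [|i s IH].
  under eq_fun do rewrite big_nil; split => [|A c G _ _ _]; first exact: Lpow_cst.
  by rewrite -[RHS](mean_cst P 0); apply: eq_mean => x; rewrite mulr0.
by under eq_fun do rewrite big_cons; exact: orthD.
Qed.

(** Stationarity: composing with the j-th iterate of [Tinv] preserves the mean, turns H into an
    F0-measurable test function and Y o T^j into Y. In effect E(Y o T^j | F_j) = 0. *)
Lemma orth_adapted m Y H c G j : orth m Y -> adapted j H -> Lpow m.+1 G ->
  (forall x, `|H x| <= c * `|G x| ^+ m) -> mean (fun x => H x * Y (iter j T x)) = 0.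
Proof.
move=> [pY Y0] mH pG HG.
have mH' := adapted_meas mH.
have := Y0 _ c (G \o iter j Tinv) mH; move=> /(_ (Lpow_iter mTinv TinvP j pG)).
move=> /(_ (fun x => HG (iter j Tinv x))) <-.
rewrite -[RHS](mean_iter mT TP j).
  by apply: eq_mean => x /=; rewrite iterTinvK.
have := @intble_iter _ _ _ _ _ mTinv TinvP (fun x => H x * Y (iter j T x)) j.
rewrite (_ : _ \o _ = fun x => (H \o iter j Tinv) x * Y x); last first.
  by apply/funext => x /=; rewrite iterTK.
by apply; exact: (Lpow_mul pG (Lpow_iter mT TP j pY) mH' HG).
Qed.

(** The tower property: an F0-measurable test function is also adapted to F_j. *)
Lemma orth_iter m Y j : orth m Y -> orth m (Y \o iter j T).
Proof.
move=> oY; split => [|A c G mA pG AG]; first by case: oY => pY _; exact: Lpow_iter.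
by apply: (orth_adapted oY _ pG AG); exact: (@adapted_le 0).
Qed.

Lemma Lpow_condexp m Y : Lpow m.+2 Y ->
  [/\ measurable_wrt F0 (E0 Y), Lpow m.+2 (E0 Y) & nrm m.+2 (E0 Y) <= 2 * nrm m.+2 Y].
Proof.
move=> pY; have IY : intble Y by apply/Lpow1; exact: Lpow_le pY.
have [mZ IZ _] := condexpP sF0 F0m IY.
suff H f : measurable_wrt F0 f -> (exists c, forall x, `|f x| <= c) ->
    mean (fun x => f x * E0 Y x) = mean (fun x => f x * Y x).
  by have [pZ nZ] := Lpow_conditional sF0 F0m mZ IZ pY H.
move=> mf [c fc]; have mf' := measurable_wrt_sub F0m mf.
have bI g : intble g -> intble (fun x => f x * g x).
  move=> Ig; apply: intble_dom (intbleZ c (intble_norm Ig)).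
    by apply: measurable_funM => //; exact: intble_meas Ig.
  by move=> x; rewrite normrM; exact: ler_wpM2r.
by apply: mean_condexp => //; exact: bI.
Qed.

Lemma orth_condexp m Y : Lpow m.+2 Y -> orth m.+1 (fun x => E0 Y x - Y x).
Proof.
move=> pY; have IY : intble Y by apply/Lpow1; exact: Lpow_le pY.
have [mZ pZ _] := Lpow_condexp pY; split => [|A c G mA pG AG]; first exact: LpowB.
have mA' := measurable_wrt_sub F0m mA.
have I1 := Lpow_mul pG pY mA' AG; have I2 := Lpow_mul pG pZ mA' AG.
under eq_fun do rewrite mulrBr.
by rewrite meanB// mean_condexp// subrr.
Qed.

(* An [F0]-measurable [h] with [h - Z] orthogonal is a version of [E(Z | F0)]. *)
Lemma nrm_orth m h Z : measurable_wrt F0 h -> Lpow m.+2 h -> Lpow m.+2 Z ->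
  orth m.+1 (fun x => h x - Z x) -> nrm m.+2 h <= 2 * nrm m.+2 Z.
Proof.
move=> mh ph pZ [_ o]; have Ih : intble h by apply/Lpow1; exact: Lpow_le ph.
suff H f : measurable_wrt F0 f -> (exists c, forall x, `|f x| <= c) ->
    mean (fun x => f x * h x) = mean (fun x => f x * Z x).
  by have [] := Lpow_conditional sF0 F0m mh Ih pZ H.
move=> mf [c fc]; have mf' := measurable_wrt_sub F0m mf.
have fc' x : `|f x| <= c * `|1 : R| ^+ m.+1 by rewrite normr1 expr1n mulr1.
have I1 := Lpow_mul (Lpow_cst P _ 1) ph mf' fc'.
have I2 := Lpow_mul (Lpow_cst P _ 1) pZ mf' fc'.
apply/eqP; rewrite -subr_eq0 -meanB//.
under eq_fun do rewrite -mulrBr.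
by rewrite (o f c (fun=> 1) mf (Lpow_cst _ _ _) fc').
Qed.


Lemma adapted_iterD i j f : adapted i f -> adapted (i + j) (f \o iter j T).
Proof.
rewrite /adapted => mf; rewrite (_ : _ \o _ = f \o iter i Tinv)//.
by apply/funext => x /=; rewrite addnC iterD iterTK.
Qed.

(** * Gordin's martingale approximation *)

Section martingale_approximation.
Variables (r N : nat) (X0 : Omega -> R).
Hypotheses (X0m : measurable_wrt F0 X0) (X0p : Lpow r.*2.+4 X0).
Local Notation p := r.*2.+4.
Local Notation q := r.+2.

Let S k x : R := \sum_(j < k) X0 (iter j.+1 T x).
Let h i : Omega -> R := E0 (S i).
Let theta x : R := N.+1%:R^-1 * \sum_(i < N.+1) h i.+1 x.
Let rr x : R := N.+1%:R^-1 * h N.+1 x.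
(* Here [n = N.+1]. Since [X0 o T + theta o T - rr o T] is the average over [i < n] of
   [X_1 + E(X_2 + ... + X_(i+1) | F_1)], whose conditional expectation given [F0] is
   [theta], the increment [e] is a martingale difference. *)
Let e x : R := X0 (T x) + (theta (T x) - rr (T x)) - theta x.
Let M k x : R := \sum_(j < k) e (iter j T x).
Let Q k x : R := \sum_(j < k) e (iter j T x) ^+ 2.
Let bbar : R := N.+1%:R^-1 * \sum_(i < N.+1) nrm p (h i.+1).

Let p0 : (0 < p)%N. Proof. by []. Qed.

Let bbar0 : 0 <= bbar.
Proof. by rewrite mulr_ge0 ?invr_ge0// sumr_ge0// => i _; exact: nrm_ge0. Qed.

Let S_split i j x : S (i + j) x = S i x + S j (iter i T x).
Proof.
rewrite /S big_split_ord/=; congr (_ + _); apply: eq_bigr => l _.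
by rewrite /= addnC iterD.
Qed.

Let pS k : Lpow p (S k).
Proof. by apply: Lpow_sum => j; exact: (Lpow_iter mT TP j.+1 X0p). Qed.

Let mh i : measurable_wrt F0 (h i). Proof. by have [] := Lpow_condexp (pS i). Qed.
Let ph i : Lpow p (h i). Proof. by have [] := Lpow_condexp (pS i). Qed.

Let oh i : orth r.*2.+3 (fun x => h i x - S i x).
Proof. exact: orth_condexp (pS i). Qed.

Let ptheta : Lpow p theta.
Proof. by apply: LpowZ; apply: Lpow_sum. Qed.

Let prr : Lpow p rr.
Proof. exact: LpowZ. Qed.

Let pe : Lpow p e.
Proof.
apply: LpowB => //; apply: LpowD; first exact: (Lpow_iter mT TP 1 X0p).
by apply: LpowB; [exact: (Lpow_iter mT TP 1 ptheta) | exact: (Lpow_iter mT TP 1 prr)].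
Qed.

Let n0 : N.+1%:R != 0 :> R.
Proof. by rewrite pnatr_eq0. Qed.

Let oe : orth r.*2.+3 e.
Proof.
pose g i x := h i x - S i x.
(* As S_(i+1) = X_1 + S_i o T, the partial sums contained in the [g] telescope to n X_1, while the
   conditional expectations give n (theta - rr) o T - n theta. *)
have -> : e = fun x => N.+1%:R^-1 * (\sum_(i < N) g i.+1 (T x) - \sum_(i < N.+1) g i.+1 x).
  apply/funext => x.
  have E : \sum_(i < N.+1) S i.+1 x = N.+1%:R * X0 (T x) + \sum_(i < N) S i.+1 (T x).
    rewrite big_ord_recl mulr_natl mulrS -addrA; congr (_ + _).
      by rewrite /S big_ord1.
    rewrite -[in X in X + _](card_ord N) -sumr_const -big_split/=.
    apply: eq_bigr => i _; rewrite -add1n S_split; congr (_ + _).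
    by rewrite /S big_ord1.
  rewrite /e /theta /rr /g !sumrB E big_ord_recr/=.
  set a := \sum_(i < N) h _ _; set b := \sum_(i < N.+1) h _ _.
  set c := \sum_(i < N) S _ _.
  by move: n0 => ?; field.
apply: orthZ; apply: orthB; apply: orth_sum => i; last exact: oh.
exact: (orth_iter 1 (oh i.+1)).
Qed.

Let nrm_theta : nrm p theta <= bbar.
Proof.
rewrite nrmZ//; last exact: Lpow_sum.
by rewrite ger0_norm ?invr_ge0// ler_wpM2l ?invr_ge0//; exact: nrm_sum.
Qed.

(** h 0 is only some version of E_0(0), so its norm is known to vanish rather than its values. *)
Let nrm_h0 : nrm p (h 0) = 0.
Proof.
apply/eqP; rewrite eq_le nrm_ge0 andbT.
have [_ _ /le_trans] := Lpow_condexp (pS 0); apply.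
have -> : S 0 = fun=> 0 by apply/funext => x; rewrite /S big_ord0.
by rewrite nrm_cst0// mulr0.
Qed.

(* Averaging [S_n = S_(i+1) + S_(N-i) o T^(i+1)] over [i]. *)
Let nrm_hn : nrm p (h N.+1) <= 4 * bbar.
Proof.
pose Z x := N.+1%:R^-1 * \sum_(i < N.+1) (h i.+1 x + h (N - i) (iter i.+1 T x)).
have pi i : Lpow p (fun x => h i.+1 x + h (N - i) (iter i.+1 T x)).
  by apply: LpowD => //; exact: (Lpow_iter mT TP i.+1 (ph (N - i))).
have pZ : Lpow p Z by apply: LpowZ; apply: Lpow_sum => i; exact: pi.
apply: (@le_trans _ _ (2 * nrm p Z)).
  apply: nrm_orth => //.
  have -> : (fun x => h N.+1 x - Z x) = fun x => (h N.+1 x - S N.+1 x) -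
     N.+1%:R^-1 * \sum_(i < N.+1) ((h i.+1 x - S i.+1 x) +
       ((fun y => h (N - i) y - S (N - i) y) \o iter i.+1 T) x).
    apply/funext => x; rewrite /Z -[RHS]addrA; congr (_ + _).
    have E : N.+1%:R * S N.+1 x =
        \sum_(i < N.+1) (S i.+1 x + S (N - i) (iter i.+1 T x)).
      have -> : N.+1%:R * S N.+1 x = \sum_(i < N.+1) S N.+1 x.
        by rewrite sumr_const card_ord mulr_natl.
      apply: eq_bigr => i _.
      have iN : (i <= N)%N by rewrite -ltnS.
      by rewrite -S_split addSn subnKC.
    apply: (mulfI n0); rewrite !mulrDr !mulrN !mulrA divff// !mul1r E -opprD.
    congr (- _); rewrite -big_split/=; apply: eq_bigr => i _; ring.
  apply: orthB; first exact: oh.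
  apply: orthZ; apply: orth_sum => i; apply: orthD; first exact: oh.
  exact: orth_iter (oh _).
rewrite (_ : 4 = 2 * 2); last by rewrite -natrM.
rewrite -mulrA ler_wpM2l// nrmZ//; last by apply: Lpow_sum => i; exact: pi.
rewrite ger0_norm ?invr_ge0// mulrCA ler_wpM2l ?invr_ge0//.
apply: (@le_trans _ _ (\sum_(i < N.+1) (nrm p (h i.+1) + nrm p (h (N - i))))).
  apply: (@le_trans _ _ (\sum_(i < N.+1) nrm p (fun x => h i.+1 x + h (N - i) (iter i.+1 T x)))).
    by apply: nrm_sum.
  apply: ler_sum => i _; apply: le_trans (nrmD _ _ _) _ => //.
    exact: (Lpow_iter mT TP i.+1 (ph (N - i))).
  by rewrite (nrm_iter mT TP i.+1 _ (ph (N - i))).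
(* Each of the two sums is at most n bbar: reversed, the second runs over h_0, ..., h_N. With the
   factor 2 of [nrm_orth] this gives 4. *)
rewrite big_split/= mulrDl !mul1r lerD2l.
rewrite (reindex_inj rev_ord_inj)/=.
have -> : \sum_(j < N.+1) nrm p (h (N - (N.+1 - j.+1))) = \sum_(j < N.+1) nrm p (h j).
  by apply: eq_bigr => j _; rewrite subSS subKn// -ltnS.
by rewrite big_ord_recl nrm_h0 add0r big_ord_recr/= lerDl nrm_ge0.
Qed.

Let nrm_rr : nrm p rr <= N.+1%:R^-1 * (4 * bbar).
Proof.
by rewrite nrmZ// ger0_norm ?invr_ge0// ler_wpM2l ?invr_ge0.
Qed.

Let nrm_e : nrm p e <= nrm p X0 + 6 * bbar.
Proof.
have pX1 := Lpow_iter mT TP 1 X0p.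
have pt1 := Lpow_iter mT TP 1 ptheta; have pr1 := Lpow_iter mT TP 1 prr.
have p1 : Lpow p (fun x => X0 (T x) + (theta (T x) - rr (T x))).
  by apply: LpowD => //; exact: LpowB.
apply: le_trans (nrmB _ p1 ptheta) _ => //.
have := @nrmD _ _ _ P p (X0 \o T) (fun x => theta (T x) - rr (T x)) p0 pX1 (LpowB pt1 pr1).
have := @nrmB _ _ _ P p (theta \o T) (rr \o T) p0 pt1 pr1.
have := nrm_iter mT TP 1 p0 X0p; have := nrm_iter mT TP 1 p0 ptheta.
have := nrm_iter mT TP 1 p0 prr.
rewrite /comp/= => -> -> ->.
have nle : N.+1%:R^-1 * (4 * bbar) <= 3 * bbar + bbar.
  have n1 : N.+1%:R^-1 <= 1 :> R by rewrite invf_le1 ?ltr0n// ler1n.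
  have b4 : 0 <= 4 * bbar by rewrite mulr_ge0.
  by apply: le_trans (ler_wpM2r b4 n1) _; rewrite mul1r; lra.
move: (le_trans nrm_rr nle) nrm_theta; lra.
Qed.

Let remainder k x : S k x - M k x =
  theta x - theta (iter k T x) + \sum_(j < k) rr (iter j.+1 T x).
Proof.
elim: k => [|k IH].
  by rewrite /S /M !big_ord0 !subrr addr0.
have -> : S k.+1 x - M k.+1 x = S k x - M k x + (X0 (iter k.+1 T x) - e (iter k T x)).
  by rewrite /S /M !big_ord_recr/=; ring.
rewrite IH big_ord_recr/= /e; ring.
Qed.

Let pM k : Lpow p (M k).
Proof. by apply: Lpow_sum => j; exact: (Lpow_iter mT TP j pe). Qed.

(** 6 = 2 + 4: two terms theta, and at most n terms of norm at most 4 bbar / n. *)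
Let nrm_remainder k : (k <= N.+1)%N -> nrm p (fun x => S k x - M k x) <= 6 * bbar.
Proof.
move=> kN; rewrite (funext (remainder k)).
have pk := Lpow_iter mT TP k ptheta.
have ps : Lpow p (fun x => \sum_(j < k) rr (iter j.+1 T x)).
  by apply: Lpow_sum => j; exact: (Lpow_iter mT TP j.+1 prr).
apply: le_trans (nrmD _ _ ps) _ => //; first exact: LpowB.
have h1 : nrm p (fun x => theta x - theta (iter k T x)) <= 2 * bbar.
  apply: le_trans (nrmB _ ptheta pk) _ => //.
  by rewrite (nrm_iter mT TP k _ ptheta)//; move: nrm_theta; lra.
have h2 : nrm p (fun x => \sum_(j < k) rr (iter j.+1 T x)) <= 4 * bbar.
  apply: (@le_trans _ _ (\sum_(j < k) nrm p (rr \o iter j.+1 T))).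
    by apply: nrm_sum => // j; exact: (Lpow_iter mT TP j.+1 prr).
  under eq_bigr => j _ do rewrite (nrm_iter mT TP j.+1 p0 prr).
  rewrite sumr_const card_ord -[leLHS]mulr_natl.
  apply: (@le_trans _ _ (N.+1%:R * (N.+1%:R^-1 * (4 * bbar)))).
    by apply: ler_pM => //; rewrite ?nrm_ge0// ler_nat.
  by rewrite mulrA divff// mul1r.
move: h1 h2; lra.
Qed.

Let adapted_e j : adapted j.+1 (e \o iter j T).
Proof.
rewrite -add1n; apply: adapted_iterD.
have mt : adapted 0 theta.
  by rewrite /theta; apply: adaptedM; [exact: adapted_cst | apply: adapted_sum => i; exact: mh].
have mr : adapted 0 rr.
  by rewrite /rr; apply: adaptedM; [exact: adapted_cst | exact: mh].
apply: adaptedB; last exact: (@adapted_le 0 1).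
apply: adaptedD; first exact: (adapted_iter 1 X0m).
by apply: adaptedB; [exact: (adapted_iter 1 mt) | exact: (adapted_iter 1 mr)].
Qed.

Let adapted_ej i j : (j < i)%N -> adapted i (fun x => e (iter j T x)).
Proof. by move=> ji; apply: (adapted_le ji); exact: adapted_e. Qed.

Let adapted_M k i : (k <= i)%N -> adapted i (M k).
Proof.
move=> ki; apply: adapted_sum => j; apply: adapted_ej.
exact: leq_trans (ltn_ord j) ki.
Qed.

Let adapted_Q k i : (k <= i)%N -> adapted i (Q k).
Proof.
move=> ki; apply: adapted_sum => j; apply: adaptedX; apply: adapted_ej.
exact: leq_trans (ltn_ord j) ki.
Qed.

Let Q0 k x : 0 <= Q k x.
Proof. by apply: sumr_ge0 => i _; exact: sqr_ge0. Qed.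

Let pQ k : Lpow q (Q k).
Proof.
apply: Lpow_sum => j; apply: (@Lpow_sqr _ _ _ P q (e \o iter j T)).
exact: (Lpow_iter mT TP j pe).
Qed.

Let IQ k : intble (fun x => Q k x ^+ q).
Proof.
have [_] := pQ k; rewrite (_ : (fun x => `|_| ^+ _) = fun x => Q k x ^+ q)//.
by apply/funext => x; rewrite ger0_norm.
Qed.

(** In the mean of [max_sqr_pathwise] the martingale transform vanishes: its i-th integrand is
    adapted to F_i, to which e o T^i is orthogonal. *)
Let max_M n : intble (fun x => runmax (fun k => M k x ^+ 2) n ^+ q) /\
  mean (fun x => runmax (fun k => M k x ^+ 2) n ^+ q) <= burk_K r * mean (fun x => Q n x ^+ q).
Proof.
pose D x (j : nat) := e (iter j T x).
pose G x := \sum_(j < n) `|D x j|.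
have pD j : Lpow p (D^~ j) by exact: (Lpow_iter mT TP j pe).
have pG : Lpow p G by apply: Lpow_sum => j; apply: Lpow_norm; exact: pD.
have mU i : adapted i (fun x => runmax (fun k => M k x ^+ 2) i).
  by apply: (@adapted_runmax i i (fun k x => M k x ^+ 2)) => k ki; apply: adaptedX; exact: adapted_M.
have mH i : adapted i (fun x => burk_H (D x) r i).
  rewrite /burk_H; apply: adaptedM; first exact: adapted_cst.
  apply: adaptedB; (apply: adaptedM; first exact: adapted_cst);
    apply: adaptedM; try exact: adapted_M.
    by apply: adaptedX; apply: adaptedX; exact: adapted_M.
  by apply: adaptedX; exact: mU.
have HG i x : (i <= n)%N -> `|burk_H (D x) r i| <= (8 * 8 ^+ r.+1 * r.+2%:R + 8) * `|G x| ^+ r.*2.+3.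
  by move=> iN; apply: burk_H_le iN _; rewrite ler_norm.
have IHD (i : 'I_n) : intble (fun x => burk_H (D x) r i * D x i).
  apply: (Lpow_mul pG (pD i)); first exact: adapted_meas (mH i).
  by move=> x; apply: HG; exact: ltnW.
have IU : intble (fun x => runmax (fun k => M k x ^+ 2) n ^+ q).
  apply: (@Lpow_intble _ _ _ P p G _ 1) => //.
    by have := adapted_meas (adaptedX q (mU n)).
  move=> x; rewrite mul1r -[p]/(q.*2) -mul2n exprM normrX lerXn2r ?nnegrE ?sqr_ge0//.
  have U0 : 0 <= runmax (fun k => M k x ^+ 2) n.
    by apply: le_trans (runmax_ge (fun k => M k x ^+ 2) (leq0n n)); exact: sqr_ge0.
  rewrite ger0_norm//; apply: runmax_le => k kn.
  rewrite -real_normK ?num_real// lerXn2r ?nnegrE//.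
  apply: le_trans (ler_norm_sum _ _ _) _; rewrite ger0_norm ?sumr_ge0//.
  by rewrite /G -(subnKC kn) big_split_ord/= lerDl sumr_ge0.
split=> //.
apply: (@le_trans _ _ (mean (fun x => \sum_(i < n) burk_H (D x) r i * D x i + burk_K r * Q n x ^+ q))).
  apply: mean_le => //.
    by apply: intbleD; [exact: intble_sum | exact: intbleZ].
  by move=> x; exact: (max_sqr_pathwise (D x)).
rewrite meanD ?meanZ//; [|exact: intble_sum|exact: intbleZ].
rewrite mean_sum// big1 ?add0r// => i _.
by apply: (orth_adapted oe (mH i) pG) => x; apply: HG; exact: ltnW.
Qed.

(* Martingale orthogonality: [Q k o T^m] and [(M k)^2 o T^m] have the same
   conditional expectation given the past of [m]. *)
Let mean_MQ m k A c G : adapted m A -> Lpow p G -> (forall x, `|A x| <= c * `|G x| ^+ r.*2.+2) ->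
  mean (fun x => A x * Q k (iter m T x)) = mean (fun x => A x * M k (iter m T x) ^+ 2).
Proof.
move=> mA pG AG.
have mA' := adapted_meas mA.
have AG2 x : `|A x| <= c * `|G x ^+ 2| ^+ r.+1 by rewrite normrX -exprM mul2n.
have pG2 : Lpow q (fun x => G x ^+ 2) by exact: Lpow_sqr.
have c0 x : 0 <= c * `|G x| ^+ r.*2.+2 by apply: le_trans (AG x).
have pq j : Lpow q (fun x => e (iter j T x) ^+ 2).
  by apply: (@Lpow_sqr _ _ _ P q (e \o iter j T)); exact: (Lpow_iter mT TP j pe).
have IA Y : Lpow q Y -> intble (fun x => A x * Y (iter m T x)).
  by move=> pY; have := Lpow_mul pG2 (Lpow_iter mT TP m pY) mA' AG2.
have IM k' : intble (fun x => A x * M k' (iter m T x) ^+ 2).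
  by apply: (IA (fun x => M k' x ^+ 2)); apply: Lpow_sqr; exact: pM.
elim: k => [|k IH].
  by apply: eq_mean => x; rewrite /Q /M !big_ord0 expr0n.
have eM x : M k.+1 x = M k x + e (iter k T x) by rewrite /M big_ord_recr.
have eQ x : Q k.+1 x = Q k x + e (iter k T x) ^+ 2 by rewrite /Q big_ord_recr.
pose C x := A x * M k (iter m T x) * e (iter (k + m) T x).
have IC : intble C /\ mean C = 0.
  have mM : adapted (k + m) (fun x => A x * M k (iter m T x)).
    apply: adaptedM; first by apply: adapted_le mA; exact: leq_addl.
    by apply: (adapted_iterD m (adapted_M (leqnn k))).
  (* V dominates both factors of the test function A (M_k o T^m), of orders p - 2 and 1, hence a
     growth of order p - 1. *)
  pose V x := `|G x| + `|M k (iter m T x)|.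
  have pV : Lpow p V.
    by apply: LpowD; apply: Lpow_norm => //; exact: (Lpow_iter mT TP m (pM k)).
  have V0 x : 0 <= V x by rewrite addr_ge0.
  have CV x : `|A x * M k (iter m T x)| <= `|c| * `|V x| ^+ r.*2.+3.
    rewrite normrM (ger0_norm (V0 x)) exprSr mulrA; apply: ler_pM => //.
      apply: le_trans (AG x) _; apply: (@le_trans _ _ (`|c| * `|G x| ^+ r.*2.+2)).
        by rewrite ler_wpM2r ?exprn_ge0// ler_norm.
      by rewrite ler_wpM2l// lerXn2r ?nnegrE// lerDl.
    by rewrite lerDr.
  split; last exact: (orth_adapted oe mM pV CV).
  exact: (Lpow_mul pV (Lpow_iter mT TP (k + m) pe) (adapted_meas mM) CV).
have E : mean (fun x => A x * M k.+1 (iter m T x) ^+ 2) =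
  mean (fun x => A x * M k (iter m T x) ^+ 2) +
  (2 * mean C + mean (fun x => A x * e (iter k T (iter m T x)) ^+ 2)).
  have I1 := IM k; have I2 := IA _ (pq k); have [I3 _] := IC.
  rewrite -meanZ// -meanD; [|exact: intbleZ|by []].
  rewrite -meanD//; last by apply: intbleD => //; exact: intbleZ.
  by apply: eq_mean => x; rewrite eM /C iterD; ring.
rewrite E IC.2 mulr0 add0r -IH -meanD; [|exact: (IA _ (pQ k))|exact: (IA _ (pq k))].
by apply: eq_mean => x; rewrite eQ mulrDr.
Qed.

(** The past A = Q_m^(q-1) is adapted to F_m, so the future Q_k may be replaced by M_k^2, then by 2
    S_k^2 + 2 (S_k - M_k)^2, and S_k^2 by its conditional expectation. Young's inequality for each
    of the two terms yields 4t. *)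
Let block m k t : (m <= k)%N -> (k <= N.+1)%N -> 0 < t ->
  mean (fun x => Q m x ^+ r.+1 * Q m (iter m T x)) <=
  4 * t * mean (fun x => Q m x ^+ q) +
  2 * t^-1 ^+ r.+1 * (nrm q (E0 (fun x => S k x ^+ 2)) ^+ q + (6 * bbar) ^+ p).
Proof.
move=> mk kN t0.
pose A x := Q m x ^+ r.+1.
have A0 x : 0 <= A x by rewrite exprn_ge0.
have mA : adapted m A by apply: adaptedX; exact: adapted_Q.
have mA' := adapted_meas mA.
have AG x : `|A x| <= 1 * `|Q m x| ^+ r.+1 by rewrite mul1r normrX.
have IA Y : Lpow q Y -> intble (fun x => A x * Y (iter m T x)).
  by move=> pY; have := Lpow_mul (pQ m) (Lpow_iter mT TP m pY) mA' AG.
have young Y : Lpow q Y -> mean (fun x => A x * Y (iter m T x)) <=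
    t * mean (fun x => Q m x ^+ q) + t^-1 ^+ r.+1 * nrm q Y ^+ q.
  move=> pY; rewrite -(nrm_iter mT TP m _ pY)// -mean_nrm//; last exact: Lpow_iter.
  have [_ IY] := Lpow_iter mT TP m pY.
  rewrite -!meanZ// -meanD; [|exact: intbleZ..].
  apply: mean_le; [exact: IA | by apply: intbleD; exact: intbleZ|] => x.
  rewrite (le_trans (ler_wpM2l (A0 x) (ler_norm _)))//.
  exact: young_pow.
have pS2 : Lpow q (fun x => S k x ^+ 2) by apply: Lpow_sqr; exact: pS.
have [_ pE _] := Lpow_condexp pS2.
have pR : Lpow p (fun x => S k x - M k x) by apply: LpowB.
have pR2 : Lpow q (fun x => (S k x - M k x) ^+ 2) by apply: Lpow_sqr.
have pM2 : Lpow q (fun x => M k x ^+ 2) by apply: Lpow_sqr; exact: pM.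
(* Monotonicity of Q in its index is what leaves k free. *)
apply: (@le_trans _ _ (mean (fun x => A x * Q k (iter m T x)))).
  apply: mean_le; [exact: IA | exact: IA|] => x.
  apply: ler_wpM2l; first exact: A0.
  rewrite /Q -(subnKC mk) big_split_ord/= lerDl.
  by rewrite sumr_ge0// => i _; exact: sqr_ge0.
pose G x := \sum_(j < m) `|e (iter j T x)|.
have pG : Lpow p G.
  apply: Lpow_sum => j; apply: (@Lpow_norm _ _ _ P p (e \o iter j T)).
  exact: (Lpow_iter mT TP j pe).
have AG' x : `|A x| <= 1 * `|G x| ^+ r.*2.+2.
  rewrite mul1r normrX -[r.*2.+2]/(r.+1.*2) -mul2n exprM lerXn2r ?nnegrE ?sqr_ge0//.
  rewrite (ger0_norm (Q0 m x)) real_normK ?num_real// /Q /G.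
  exact: (sum_sqr_le m (fun j => e (iter j T x))).
rewrite (mean_MQ k mA pG AG').
apply: (@le_trans _ _ (2 * mean (fun x => A x * S k (iter m T x) ^+ 2) +
    2 * mean (fun x => A x * (S k (iter m T x) - M k (iter m T x)) ^+ 2))).
  have I1 := IA _ pS2; have I2 := IA _ pR2.
  rewrite -!meanZ// -meanD; [|exact: intbleZ..].
  apply: mean_le; [exact: (IA _ pM2) | by apply: intbleD; exact: intbleZ|] => x.
  set a := S k _; set b := M k _.
  have -> : 2 * (A x * a ^+ 2) + 2 * (A x * (a - b) ^+ 2) = A x * (2 * a ^+ 2 + 2 * (a - b) ^+ 2).
    by ring.
  by rewrite ler_wpM2l//; have := sqr_ge0 (2 * a - b); nra.
have -> : mean (fun x => A x * S k (iter m T x) ^+ 2) =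
    mean (fun x => A x * E0 (fun x => S k x ^+ 2) (iter m T x)).
  apply/eqP; rewrite eq_sym -subr_eq0 -meanB; [|exact: (IA _ pE)|exact: (IA _ pS2)].
  under eq_fun do rewrite -mulrBr.
  by rewrite (orth_adapted (orth_condexp pS2) mA (pQ m) AG).
have h1 := young _ pE; have h2 := young _ pR2.
have h3 : nrm q (fun x => (S k x - M k x) ^+ 2) ^+ q <= (6 * bbar) ^+ p.
  apply: (@le_trans _ _ (nrm p (fun x => S k x - M k x) ^+ p)); last first.
    have b60 : 0 <= 6 * bbar by apply: mulr_ge0; last exact: bbar0.
    apply: lerXn2r; rewrite ?nnegrE ?nrm_ge0//.
    exact: nrm_remainder.
  rewrite -!mean_nrm// le_eqVlt; apply/predU1P; left; apply: eq_mean => x.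
  by rewrite normrX -exprM mul2n.
have t1 : 0 <= t^-1 ^+ r.+1 by rewrite exprn_ge0// invr_ge0 ltW.
have h4 := ler_wpM2l t1 h3.
move: h1 h2 h4; lra.
Qed.

(** * Recursion for the moments of the quadratic variation *)

Let xq k : R := mean (fun x => Q k x ^+ q).

Let xq0 k : 0 <= xq k.
Proof. by apply: mean_ge0 => x; rewrite exprn_ge0. Qed.

Let Q_split i j x : Q (i + j) x = Q i x + Q j (iter i T x).
Proof.
rewrite /Q big_split_ord/=; congr (_ + _); apply: eq_bigr => l _.
by rewrite addnC iterD.
Qed.

Let xq_iter m : intble (fun x => Q m (iter m T x) ^+ q) /\
  mean (fun x => Q m (iter m T x) ^+ q) = xq m.
Proof.
split; first exact: (intble_iter mT TP m (IQ m)).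
exact: (mean_iter mT TP m (IQ m)).
Qed.

Let xq_double i j : (i <= j)%N -> (j <= i.*2)%N -> xq j <= 2 ^+ r.+3 * xq i.
Proof.
move=> ij ji; have [I1 E1] := xq_iter i.
have -> : 2 ^+ r.+3 * xq i = mean (fun x => 2 ^+ q * (Q i x ^+ q + Q i (iter i T x) ^+ q)).
  by rewrite meanZ ?meanD ?E1 /xq//; [rewrite [2 ^+ r.+3]exprS; ring | exact: intbleD].
apply: mean_le => //; first by apply: intbleZ; exact: intbleD.
move=> x; apply: le_trans (exprD_le _ (Q0 _ _) (Q0 _ _)).
rewrite lerXn2r ?nnegrE ?addr_ge0// -Q_split addnn -(subnKC ji) Q_split lerDl.
exact: Q0.
Qed.

Let xq_step m k (l t : R) : (m <= k)%N -> (k <= N.+1)%N -> 0 < l -> l <= 1 -> 0 < t ->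
  xq m.*2 <= 2 * xq m + 2 ^+ q * (l * xq m + l^-1 ^+ r *
    (4 * t * xq m + 2 * t^-1 ^+ r.+1 *
      (nrm q (E0 (fun x => S k x ^+ 2)) ^+ q + (6 * bbar) ^+ p))).
Proof.
move=> mk kN l0 l1 t0; have [I1 E1] := xq_iter m.
have I2 : intble (fun x => Q m x ^+ r.+1 * Q m (iter m T x)).
  have mA' := adapted_meas (adaptedX r.+1 (adapted_Q (leqnn m))).
  apply: (@Lpow_mul _ _ _ P r.+1 (Q m) _ (Q m \o iter m T) 1) => //.
    exact: (Lpow_iter mT TP m (pQ m)).
  by move=> x; rewrite mul1r normrX.
apply: (@le_trans _ _ (mean (fun x => (Q m x ^+ q + Q m (iter m T x) ^+ q) +
   2 ^+ q * (l * Q m (iter m T x) ^+ q + l^-1 ^+ r * (Q m x ^+ r.+1 * Q m (iter m T x)))))).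
  apply: mean_le => //.
    apply: intbleD; first exact: intbleD.
    by apply: intbleZ; apply: intbleD; exact: intbleZ.
  by move=> x; rewrite -addnn Q_split; exact: block_ineq.
rewrite meanD; [|exact: intbleD|by apply: intbleZ; apply: intbleD; exact: intbleZ].
rewrite meanD// meanZ; last by apply: intbleD; exact: intbleZ.
rewrite meanD; [|exact: intbleZ..].
rewrite !meanZ// E1 -/(xq m) mulrDl mul1r lerD2l ler_wpM2l ?exprn_ge0// lerD2l.
by rewrite ler_wpM2l ?exprn_ge0 ?invr_ge0 ?(ltW l0)//; exact: block.
Qed.

Let G : R := \sum_(1 <= k < N.+2) 1 / k%:R `^ (1 + (q * r.+1)%:R^-1) *
  nrm q (E0 (fun x => S k x ^+ 2)) `^ r.+1%:R^-1.

Let b60 : 0 <= 6 * bbar.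
Proof. by apply: mulr_ge0; last exact: bbar0. Qed.

Let G0 : 0 <= G.
Proof. by apply: sumr_ge0 => k _; rewrite mulr_ge0 ?divr_ge0 ?powR_ge0. Qed.

(** The same b = (|X0|_p + 6 bbar)^p bounds the starting value E |e|^p and the error (6 bbar)^p of
    each step. *)
Let xq_bound : xq N.+1 <= rec_C r * N.+1%:R *
  ((nrm p X0 + 6 * bbar) ^+ p + G ^+ (q * r.+1)).
Proof.
have b6 : (6 * bbar) ^+ p <= (nrm p X0 + 6 * bbar) ^+ p.
  by rewrite lerXn2r ?nnegrE ?addr_ge0 ?nrm_ge0// lerDr nrm_ge0.
have nX0 : 0 <= nrm p X0 + 6 * bbar by rewrite addr_ge0// nrm_ge0.
apply: (@dyadic_recursion _ r N.+1 xq (fun k => nrm q (E0 (fun x => S k x ^+ 2)))) => //.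
- by move=> k; exact: nrm_ge0.
- by rewrite exprn_ge0.
- apply: (@le_trans _ _ (nrm p e ^+ p)); last by rewrite lerXn2r ?nnegrE ?nrm_ge0.
  rewrite -mean_nrm// /xq le_eqVlt; apply/predU1P; left; apply: eq_mean => x.
  by rewrite /Q big_ord1/= -[p]/(q.*2) -mul2n exprM real_normK ?num_real.
- move=> m k l t m0 mk kN l0 l1 t0; apply: le_trans (xq_step mk kN l0 l1 t0) _.
  rewrite lerD2l ler_wpM2l ?exprn_ge0// lerD2l ler_wpM2l ?exprn_ge0 ?invr_ge0 ?(ltW l0)//.
  by rewrite lerD2l ler_wpM2l ?mulr_ge0 ?exprn_ge0 ?invr_ge0 ?(ltW t0)// lerD2l.
Qed.

(** One integrable majorant W of all |S_j|^p stands for the maximum. *)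
Lemma max_partial_sum_bound : exists W : Omega -> R,
  [/\ intble W,
      forall j x, (j <= N.+1)%N -> `|S j x| ^+ p <= W x &
      mean W <= max_C r * N.+1%:R * (nrm p X0 ^+ p + bbar ^+ p + G ^+ (q * r.+1))].
Proof.
pose n := N.+1.
pose W1 x := runmax (fun k => M k x ^+ 2) n ^+ q.
pose W2 x := `|theta x| ^+ p.
pose W3 x := \sum_(l < n.+1) `|theta (iter l T x)| ^+ p.
pose W4 x := \sum_(l < n) `|rr (iter l.+1 T x)| ^+ p.
have [I1 E1] : intble W1 /\ mean W1 <= burk_K r * xq n by exact: max_M.
have [I2 E2] : intble W2 /\ mean W2 <= bbar ^+ p.
  split; first by case: ptheta.
  by rewrite /W2 mean_nrm// lerXn2r ?nnegrE ?nrm_ge0.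
have It l : intble (fun x => `|theta (iter l T x)| ^+ p).
  by have [] := Lpow_iter mT TP l ptheta.
have Ir l : intble (fun x => `|rr (iter l.+1 T x)| ^+ p).
  by have [] := Lpow_iter mT TP l.+1 prr.
have [I3 E3] : intble W3 /\ mean W3 <= n.+1%:R * bbar ^+ p.
  split; first by apply: intble_sum => l; exact: It.
  rewrite mean_sum// mulr_natl -[in leRHS](card_ord n.+1) -sumr_const; apply: ler_sum => l _.
  rewrite (_ : mean _ = mean W2)//; exact: (mean_iter mT TP l I2).
have [I4 E4] : intble W4 /\ n%:R ^+ p * mean W4 <= n%:R * (4 * bbar) ^+ p.
  split; first by apply: intble_sum => l; exact: Ir.
  rewrite mean_sum//.
  under eq_bigr => l _.
    rewrite (_ : mean _ = nrm p rr ^+ p); last first.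
      rewrite -(nrm_iter mT TP l.+1 p0 prr) -mean_nrm//.
      exact: (Lpow_iter mT TP l.+1 prr).
    over.
  rewrite sumr_const card_ord -[X in _ * X]mulr_natl mulrCA ler_wpM2l// -exprMn.
  have b40 : 0 <= 4 * bbar by apply: mulr_ge0; last exact: bbar0.
  have nr : n%:R * nrm p rr <= 4 * bbar.
    by apply: le_trans (ler_wpM2l (ler0n _ _) nrm_rr) _; rewrite mulrA divff// mul1r.
  by rewrite lerXn2r ?nnegrE// mulr_ge0 ?nrm_ge0.
exists (fun x => 2 ^+ p * (W1 x + 4 ^+ p * (W2 x + W3 x + n%:R ^+ p * W4 x))).
have I23 : intble (fun x => W2 x + W3 x) by exact: intbleD.
have I4' : intble (fun x => n%:R ^+ p * W4 x) by exact: intbleZ.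
have I5 : intble (fun x => W2 x + W3 x + n%:R ^+ p * W4 x) by exact: intbleD.
have I6 : intble (fun x => W1 x + 4 ^+ p * (W2 x + W3 x + n%:R ^+ p * W4 x)).
  by apply: intbleD => //; exact: intbleZ.
split; first exact: intbleZ.
  move=> j x jn.
  have -> : S j x = M j x + (S j x - M j x) by rewrite addrC subrK.
  rewrite remainder.
  set a := theta x; set b := theta _; set c := \sum_(_ < j) _.
  apply: (@le_trans _ _ (2 ^+ p * (`|M j x| ^+ p + (`|a| + `|b| + `|c|) ^+ p))).
    have abc0 : 0 <= `|a| + `|b| + `|c| by rewrite !addr_ge0.
    apply: le_trans (exprD_le p (normr_ge0 (M j x)) abc0).
    rewrite lerXn2r ?nnegrE ?(addr_ge0 _ abc0)//.
    by rewrite (le_trans (ler_normD _ _))// lerD2l (le_trans (ler_normD _ _))// lerD2r ler_normB.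
  rewrite ler_wpM2l ?exprn_ge0// lerD//.
    rewrite -[p]/(q.*2) -mul2n exprM real_normK ?num_real// /W1.
    have Mj := runmax_ge (fun k => M k x ^+ 2) jn.
    by rewrite lerXn2r ?nnegrE ?sqr_ge0// (le_trans (sqr_ge0 _) Mj).
  have h1 := @exprD_le R p (`|a| + `|b|) `|c|.
  have h2 := @exprD_le R p `|a| `|b| (normr_ge0 _) (normr_ge0 _).
  have {}h1 := h1 (addr_ge0 (normr_ge0 _) (normr_ge0 _)) (normr_ge0 _).
  have p2 : 1 <= 2 ^+ p :> R by rewrite exprn_ege1// ler1n.
  have c0 : 0 <= `|c| ^+ p by rewrite exprn_ge0.
  have h3 : (`|a| + `|b| + `|c|) ^+ p <= 4 ^+ p * (`|a| ^+ p + `|b| ^+ p + `|c| ^+ p).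
    have e4 : 4 ^+ p = 2 ^+ p * 2 ^+ p :> R by rewrite -exprMn -natrM.
    have h4 : `|c| ^+ p <= 2 ^+ p * `|c| ^+ p by rewrite ler_peMl.
    have h5 : (`|a| + `|b|) ^+ p + `|c| ^+ p <= 2 ^+ p * (`|a| ^+ p + `|b| ^+ p + `|c| ^+ p).
      by rewrite mulrDr lerD.
    rewrite e4 -(mulrA (2 ^+ p)); apply: (le_trans h1).
    by apply: ler_wpM2l h5; exact: exprn_ge0.
  apply: (le_trans h3); rewrite ler_wpM2l ?exprn_ge0// lerD//.
    (* The maximum of |theta o T^j|^p over j <= n is bounded by the sum of these n+1 terms, which
       the factor n of the target permits. *)
    rewrite lerD2l /W3 (bigD1 (Ordinal (jn : (j < n.+1)%N)))//= lerDl.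
    by rewrite sumr_ge0// => l _; rewrite exprn_ge0.
  apply: le_trans (@expr_sum_le R n _ (fun l => `|rr (iter l.+1 T x)|) _) => //.
  rewrite lerXn2r ?nnegrE ?sumr_ge0// (le_trans (ler_norm_sum _ _ _))//.
  by rewrite /n -(subnKC jn) big_split_ord/= lerDl sumr_ge0.
rewrite meanZ// meanD//; last exact: intbleZ.
rewrite meanZ// meanD// meanD// meanZ//.
have nX := nrm_ge0 P p X0.
have hX : (nrm p X0 + 6 * bbar) ^+ p + G ^+ (q * r.+1) <=
    2 ^+ p * 6 ^+ p * (nrm p X0 ^+ p + bbar ^+ p + G ^+ (q * r.+1)).
  have hD := exprD_le p nX b60.
  have p2 : 1 <= 2 ^+ p :> R by rewrite exprn_ege1// ler1n.
  have p6 : 1 <= 6 ^+ p :> R by rewrite exprn_ege1// ler1n.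
  have Gp : 0 <= G ^+ (q * r.+1) by exact: exprn_ge0.
  have n1 : nrm p X0 ^+ p <= 6 ^+ p * nrm p X0 ^+ p by rewrite ler_peMl ?exprn_ge0.
  have G1 : G ^+ (q * r.+1) <= 2 ^+ p * (6 ^+ p * G ^+ (q * r.+1)).
    have x6 : 0 <= 6 ^+ p * G ^+ (q * r.+1) by apply: mulr_ge0 => //; exact: exprn_ge0.
    exact: le_trans (ler_peMl Gp p6) (ler_peMl x6 p2).
  rewrite -(mulrA (2 ^+ p)); set g := G ^+ _ in G1 *.
  have -> : 2 ^+ p * (6 ^+ p * (nrm p X0 ^+ p + bbar ^+ p + g)) =
     2 ^+ p * (6 ^+ p * nrm p X0 ^+ p + (6 * bbar) ^+ p) + 2 ^+ p * (6 ^+ p * g).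
    by rewrite (exprMn p 6 bbar) -!mulrDr.
  apply: lerD => //; apply: (le_trans hD); apply: ler_wpM2l; first exact: exprn_ge0.
  by rewrite lerD2r.
have B0 : 0 <= burk_K r :> R by rewrite /burk_K /burk_c; nonneg.
have C0 : 0 <= rec_C r :> R by exact: rec_C_ge0.
have N0 : 0 <= N.+1%:R :> R by [].
set Y := nrm p X0 ^+ p + bbar ^+ p + G ^+ (q * r.+1).
have hB : bbar ^+ p <= Y by rewrite /Y addrAC lerDr addr_ge0 ?exprn_ge0.
have f1 : mean W1 <= burk_K r * (rec_C r * N.+1%:R * (2 ^+ p * 6 ^+ p * Y)).
  apply: (le_trans E1); rewrite ler_wpM2l//; apply: (le_trans xq_bound).
  by rewrite ler_wpM2l// mulr_ge0.
have f2 : mean W2 + mean W3 + n%:R ^+ p * mean W4 <= N.+1%:R * ((3 + 4 ^+ p) * Y).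
  have g1 : mean W2 <= N.+1%:R * Y.
    apply: (le_trans E2); apply: (le_trans hB).
    by rewrite ler_peMl ?ler1n// (le_trans _ hB)// exprn_ge0.
  have g2 : mean W3 <= N.+1%:R * (2 * Y).
    apply: (le_trans E3); rewrite mulrA; apply: ler_pM => //; first exact: exprn_ge0.
    by rewrite -natrM ler_nat /n muln2 -addnn addSn ltnS leq_addl.
  have g3 : n%:R ^+ p * mean W4 <= N.+1%:R * (4 ^+ p * Y).
    apply: (le_trans E4); rewrite exprMn ler_wpM2l// ler_wpM2l ?exprn_ge0//.
  move: g1 g2 g3; rewrite mulrDl !mulrDr; lra.
rewrite /max_C; apply: (@le_trans _ _ (2 ^+ p * (burk_K r * (rec_C r * N.+1%:R * (2 ^+ p * 6 ^+ p * Y)) +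
   4 ^+ p * (N.+1%:R * ((3 + 4 ^+ p) * Y))))).
  by rewrite ler_wpM2l ?exprn_ge0// lerD// ler_wpM2l ?exprn_ge0.
by rewrite le_eqVlt; apply/predU1P; left; ring.
Qed.

End martingale_approximation.
End dynamics.

(** * The theorem *)

Lemma partial_sumE {d : measure_display} {Omega : measurableType d} {R : realType} (T Tinv : Omega -> Omega)
    (X0 : Omega -> R) n :
  partial_sum (stationary T Tinv X0) n = fun x => \sum_(j < n) X0 (iter j.+1 T x).
Proof. by apply/funext => x; rewrite /partial_sum big_add1/= big_mkord. Qed.

Lemma measurable_bigmax {d : measure_display} {Omega : measurableType d} {R : realType}
    (I : Type) (s : seq I) (f : I -> Omega -> R) :
  (forall i, measurable_fun setT (f i)) ->
  measurable_fun setT (fun x => \big[Num.max/0]_(i <- s) f i x).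
Proof.
move=> mf; elim: s => [|i s IH].
  by under eq_fun do rewrite big_nil; exact: measurable_cst.
by under eq_fun do rewrite big_cons; exact: measurable_maxr.
Qed.

Theorem theorem17 (R : realType) (p : nat) (p_ge4 : (4 <= p)%N) (p_even : ~~ odd p) :
  exists C : R,
    forall (d : measure_display) (Omega : measurableType d)
      (P : probability Omega R)
      (T Tinv : Omega -> Omega)
      (TK : cancel T Tinv) (TinvK : cancel Tinv T)
      (mT : measurable_fun [set: Omega] T)
      (mTinv : measurable_fun [set: Omega] Tinv)
      (TP : forall A : set Omega, measurable A -> P (T @^-1` A) = P A)
      (F0 : set (set Omega))
      (sF0 : sigma_algebra [set: Omega] F0)
      (F0m : F0 `<=` measurable)
      (F0T : F0 `<=` preimage_set_system [set: Omega] T F0)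
      (X0 : Omega -> R)
      (X0_adapted : measurable_wrt F0 X0)
      (X0_Lp : X0 \in Lfun P p%:R%:E),
    let X := stationary T Tinv X0 in
    let S := partial_sum X in
    let E0 := condexp P F0 in
    forall n : nat, (0 < n)%N ->
    ('E_P[fun x => \big[Num.max/0%R]_(1 <= j < n.+1) (`|S j x| ^+ p)%R]
     <= C%:E *
        (n%:R%:E * 'N[P]_(p%:R%:E)[EFin \o X0] `^ p%:R
         + (n%:R `^ (1 - p%:R))%:E
           * (\sum_(1 <= i < n.+1) 'N[P]_(p%:R%:E)[EFin \o E0 (S i)]) `^ p%:R
         + n%:R%:E
           * (\sum_(1 <= k < n.+1)
                (1 / k%:R `^ (1 + 4 / (p%:R * (p%:R - 2))))%:E
                * 'N[P]_((p%:R / 2)%:E)[EFin \o E0 (fun x => (S k x ^+ 2)%R)]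
                  `^ (2 / (p%:R - 2)))
             `^ (p%:R * (p%:R - 2) / 4)))%E.
Proof.
(* r = p/2 - 2, so q = r+2 and q - 1 = r+1 are positive by construction. *)
have [r pE] : exists r, p = r.*2.+4.
  exists (p./2 - 2)%N; move: p p_ge4 p_even => [|[|[|[|p']]]]// _.
  rewrite /= !negbK => ev.
  by rewrite subSS subSS subn0 -[LHS](odd_double_half p'.+4)/= !negbK (negbTE ev).
move: p_ge4 p_even; rewrite pE => _ _.
exists (max_C r) => d Omega P T Tinv TK TinvK mT mTinv TP F0 sF0 F0m F0T X0 X0m X0_Lp.
move=> X S E0 [//|N] _.
have X0p : Lpow P r.*2.+4 X0 by exact: Lfun_Lpow.
have SE k : S k = fun x => \sum_(j < k) X0 (iter j.+1 T x) by exact: partial_sumE.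
have pS k : Lpow P r.*2.+4 (S k).
  by rewrite SE; apply: Lpow_sum => j; exact: (Lpow_iter mT TP j.+1 X0p).
have pE0 k : Lpow P r.*2.+4 (E0 (S k)) by have [] := Lpow_condexp sF0 F0m (pS k).
have pE2 k : Lpow P r.+2 (E0 (fun x => S k x ^+ 2)).
  by have [] := Lpow_condexp sF0 F0m (@Lpow_sqr _ _ _ P r.+2 _ (pS k)).
have [W [IW SW mW]] :=
  max_partial_sum_bound TK TinvK mT mTinv TP sF0 F0m F0T N X0m X0p.
have W0 x : 0 <= W x by apply: le_trans (SW 0%N x _) => //; rewrite exprn_ge0.
set n := N.+1; have n0 : n%:R != 0 :> R by rewrite pnatr_eq0.
apply: (@le_trans _ _ (mean P W)%:E).
  rewrite unlock -mean_EFin//; apply: ge0_le_integral => //.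
  - move=> x _; rewrite lee_fin; exact: bigmax_ge_id.
  - apply/measurable_EFinP; apply: measurable_bigmax => j.
    apply: measurable_funX; apply: measurableT_comp => //; by case: (pS j).
  - by apply/measurable_EFinP; exact: intble_meas IW.
  - move=> x _; rewrite lee_fin big_nat; apply: bigmax_le => // j /andP[_ jn].
    by rewrite SE; exact: SW.
have {}mW : mean P W <= max_C r * n%:R * (nrm P r.*2.+4 X0 ^+ r.*2.+4 +
    (n%:R^-1 * \sum_(1 <= i < n.+1) nrm P r.*2.+4 (E0 (S i))) ^+ r.*2.+4 +
    (\sum_(1 <= k < n.+1) 1 / k%:R `^ (1 + (r.+2 * r.+1)%:R^-1) *
      nrm P r.+2 (E0 (fun x => S k x ^+ 2)) `^ r.+1%:R^-1) ^+ (r.+2 * r.+1)).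
  by rewrite (big_add1 _ _ _ _ _ (fun i => nrm P r.*2.+4 (E0 (S i)))) big_mkord (funext SE).
(* With p = 2q the exponents of the statement are 2/(p-2) = 1/(q-1), 4/(p(p-2)) = 1/s and p(p-2)/4 =
   s, where s = q(q-1). *)
have e0 : r.*2.+4%:R = 2 * r.+2%:R :> R by rewrite -natrM mul2n.
have e1 : r.*2.+4%:R / 2 = r.+2%:R :> R by rewrite e0 mulrAC divff ?mul1r.
have e2 : (r.*2.+4%:R - 2 : R) = 2 * r.+1%:R.
  by rewrite e0 -addn1 natrD; ring.
have r1 : r.+1%:R != 0 :> R by rewrite pnatr_eq0.
have r2 : r.+2%:R != 0 :> R by rewrite pnatr_eq0.
have e3 : 2 / (2 * r.+1%:R) = r.+1%:R^-1 :> R.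
  by move: r1; move: (r.+1%:R) => a a0; field.
have e4 : 4 / (2 * r.+2%:R * (2 * r.+1%:R)) = (r.+2 * r.+1)%:R^-1 :> R.
  rewrite natrM; move: r1 r2; move: (r.+1%:R) (r.+2%:R) => a b a0 b0.
  by field; rewrite ?a0 ?b0.
have e5 : 2 * r.+2%:R * (2 * r.+1%:R) / 4 = (r.+2 * r.+1)%:R :> R.
  by rewrite natrM; move: r.+1%:R r.+2%:R => a b; field.
rewrite e1 e2 e3; rewrite [r.*2.+4%:R * (2 * _)](_ : _ = 2 * r.+2%:R * (2 * r.+1%:R)) ?e0// e4 e5.
rewrite -e0 Lnorm_nrm//.
under eq_bigr => i _ do rewrite Lnorm_nrm//.
under [X in (_ + _ + _ * X `^ _)%E]eq_bigr => k _ do rewrite Lnorm_nrm// poweR_EFin -EFinM.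
rewrite !sumEFin !poweR_EFin -!EFinM lee_fin.
rewrite !powR_mulrn ?nrm_ge0 ?sumr_ge0//; first last.
  by move=> i _; exact: nrm_ge0.
  by move=> i _; rewrite mulr_ge0 ?divr_ge0 ?powR_ge0.
apply: (le_trans mW).
(* n^(1-p) times the p-th power of the sum is n times the p-th power of the average bbar. *)
have -> : n%:R `^ (1 - r.*2.+4%:R) = n%:R * n%:R^-1 ^+ r.*2.+4 :> R.
  rewrite powRD; last by rewrite n0 implybT.
  by rewrite powRr1// powRN powR_mulrn// exprVn.
by rewrite exprMn le_eqVlt; apply/predU1P; left; ring.
Qed.
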